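(* Let $E^\bullet$ be a simplicial deformation complex. Then $\mathrm{Def}_E$ is a deformation functor, with tangent space $\mathrm{H}^1(E)$ and complete obstruction space $\mathrm{H}^2(E)$. For $A\in\mathcal{C}_\Lambda$ and $\omega,\omega'\in\mathrm{MC}_E(A)$, the functor $\mathrm{Iso}(\omega,\omega')$ is homogeneous, with tangent space $\mathrm{H}^0(E)$ and complete obstruction space $\mathrm{H}^1(E)$. Moreover, if $\mathrm{H}^0(E)=0$, then $\mathrm{Def}_E$ is homogeneous.
   Context: $\Lambda$ is a complete Noetherian local ring with residue field $k$; $\mathcal{C}_\Lambda$ is the category of Artinian local $\Lambda$-algebras with residue field $k$ (similarly $\mathcal{C}_A$ for $A\in\mathcal{C}_\Lambda$). Deformation-theoretic functors $F$ on $\mathcal{C}_\Lambda$ satisfy $F(k)=$ point. Tangent space: $t_F=F(k[\epsilon])$, $\epsilon^2=0$. $F$ is smooth if $F(B)\to F(A)$ is surjective for every surjection $B\to A$. Let $\eta:F(B\times_AC)\to F(B)\times_{F(A)}F(C)$; $F$ is homogeneous if $\eta$ is bijective whenever $B\to A$ is surjective; $F$ is a deformation functor if $\eta$ is surjective whenever $B\to A$ is surjective and bijective whenever $A=k$. An obstruction theory for $F$ is a $k$-vector space $V$ with, for each small extension $e:0\to J\to A\to B\to0$ ($\mathfrak{m}_AJ=0$), a map $v_e:F(B)\to V\otimes_kJ$ vanishing on elements that lift to $F(A)$ and functorial in $e$; it is complete (and $V$ is a complete obstruction space) if $v_e(x)=0$ implies that $x$ lifts to $F(A)$. A simplicial deformation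 complex (SDC) $E^\bullet$ consists of smooth homogeneous functors $E^n:\mathcal{C}_\Lambda\to\mathrm{Set}$, $n\ge0$, maps $\partial^i:E^n\to E^{n+1}$ ($1\le i\le n$), $\sigma^i:E^n\to E^{n-1}$ ($0\le i<n$), and an associative product $*:E^m\times E^n\to E^{m+n}$ with identity $1\in E^0$, such that: $\partial^j\partial^i=\partial^i\partial^{j-1}$ for $i<j$; $\sigma^j\sigma^i=\sigma^i\sigma^{j+1}$ for $i\le j$; $\sigma^j\partial^i$ equals $\partial^i\sigma^{j-1}$ if $i<j$, $\mathrm{id}$ if $i=j,j+1$, $\partial^{i-1}\sigma^j$ if $i>j+1$; $\partial^i(e)*f=\partial^i(e*f)$; $e*\partial^i(f)=\partial^{i+m}(e*f)$; $\sigma^i(e)*f=\sigma^i(e*f)$; $e*\sigma^i(f)=\sigma^{i+m}(e*f)$, for $e\in E^m$. $E^0$ is a group under $*$. $\mathrm{MC}_E(A)=\{\omega\in E^1(A):\omega*\omega=\partial^1(\omega)\}$; $\mathrm{Def}_E=\mathrm{MC}_E/E^0$, the quotient by $\omega\mapsto g*\omega*g^{-1}$. For $\omega,\omega'\in\mathrm{MC}_E(A)$, $\mathrm{Iso}(\omega,\omega'):\mathcal{C}_A\to\mathrm{Set}$ sends $f:A\to B$ to $\{g\in E^0(B): g*f(\omega)*g^{-1}=f(\omega')\}$. Let $\omega_0$ be the unique element of $E^1(k)$, and for $k$-algebras in $\mathcal{C}_k\subset\mathcal{C}_\Lambda$ put $\partial^0(e)=\omega_0*e$, $\partial^{n+1}(e)=e*\omega_0$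 for $e\in E^n$. Then $\mathrm{C}^n(E)=E^n(k[\epsilon])$ is a cosimplicial $k$-vector space, and $\mathrm{H}^i(E)$ is the cohomology of $\mathrm{C}^\bullet(E)$ with $d=\sum_i(-1)^i\partial^i$. *)

(* Defs.v *)
From HB Require Import structures.
From mathcomp Require Import all_boot all_order all_algebra.
From mathcomp Require Import boolp.

Set Implicit Arguments.
Unset Strict Implicit.
Unset Printing Implicit Defensive.

Import GRing.Theory.
Local Open Scope ring_scope.
Local Open Scope quotient_scope.

Section Rings.
Variable R : comNzRingType.

Definition is_unit (x : R) : Prop := exists y, y * x = 1.

Definition is_local : Prop :=
  forall x y : R, ~ is_unit x -> ~ is_unit y -> ~ is_unit (x + y).

Definition max_ideal (x : R) : Prop := ~ is_unit x.

Definition is_ideal (I : R -> Prop) : Prop :=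
  [/\ I 0, forall x y, I x -> I y -> I (x + y) & forall a x, I x -> I (a * x)].

Definition is_noetherian : Prop :=
  forall I, is_ideal I -> exists n (g : 'I_n -> R),
    (forall i, I (g i)) /\
    (forall x, I x -> exists c : 'I_n -> R, x = \sum_i c i * g i).

Definition is_artinian : Prop :=
  forall I : nat -> R -> Prop,
    (forall n, is_ideal (I n)) -> (forall n x, I n.+1 x -> I n x) ->
    exists N, forall n x, (N <= n)%N -> I N x -> I n x.

Definition ideal_mul (I J : R -> Prop) (x : R) : Prop :=
  exists n (a b : 'I_n -> R),
    [/\ forall i, I (a i), forall i, J (b i) & x = \sum_i a i * b i].

Fixpoint ideal_exp (I : R -> Prop) (n : nat) : R -> Prop :=
  if n is n'.+1 then ideal_mul I (ideal_exp I n') else fun=> True.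

(* R -> lim R/I^n is bijective. *)
Definition is_adically_complete (I : R -> Prop) : Prop :=
  forall x : nat -> R, (forall n, ideal_exp I n (x n.+1 - x n)) ->
  exists! l : R, forall n, ideal_exp I n (l - x n).

Definition complete_noetherian_local : Prop :=
  [/\ is_local, is_noetherian & is_adically_complete max_ideal].

End Rings.

Arguments is_local : clear implicits.
Arguments is_noetherian : clear implicits.
Arguments is_artinian : clear implicits.
Arguments complete_noetherian_local : clear implicits.

(* The category C_R of Artinian local R-algebras with residue field k.  The
   base is a ring R with a map pi : R -> k, which for R local and pi surjective
   presents k as its residue field.  Algebras are given by structure morphisms
   rather than by [comAlgType R], so that restriction of scalars is
   composition.  As art_ring is local and art_res is surjective, the kernel of
   art_res is the maximal ideal. *)
Record art (R : comNzRingType) (k : fieldType) (pi : {rmorphism R -> k}) := Art {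
  art_ring :> comNzRingType;
  art_str : {rmorphism R -> art_ring};
  art_res : {rmorphism art_ring -> k};
  art_res_str : forall r, art_res (art_str r) = pi r;
  art_res_surj : forall c, exists x, art_res x = c;
  art_local : is_local art_ring;
  art_artinian : is_artinian art_ring }.

(* Local homomorphisms of R-algebras.  When pi is surjective, hom_res is
   automatic: f maps the nilpotent ideal m_A into m_B. *)
Record hom (R : comNzRingType) (k : fieldType) (pi : {rmorphism R -> k})
    (A B : art pi) := Hom {
  hom_fun :> {rmorphism A -> B};
  hom_str : forall r, hom_fun (art_str A r) = art_str B r;
  hom_res : forall x, art_res B (hom_fun x) = art_res A x }.

Section Homs.
Variables (R : comNzRingType) (k : fieldType) (pi : {rmorphism R -> k}).
Implicit Types A B C : art pi.

Lemma hid_str A r : idfun (art_str A r) = art_str A r. Proof. by []. Qed.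
Lemma hid_res A x : art_res A (idfun x) = art_res A x. Proof. by []. Qed.
Definition hid A : hom A A := @Hom R k pi A A idfun (@hid_str A) (@hid_res A).

Section Comp.
Variables (A B C : art pi) (g : hom B C) (f : hom A B).
Lemma hcomp_str r : (g \o f) (art_str A r) = art_str C r.
Proof. by rewrite /= !hom_str. Qed.
Lemma hcomp_res x : art_res C ((g \o f) x) = art_res A x.
Proof. by rewrite /= !hom_res. Qed.
Definition hcomp : hom A C := @Hom R k pi A C (g \o f) hcomp_str hcomp_res.
End Comp.

Definition hsurj A B (f : hom A B) : Prop := forall b, exists a, f a = b.

(* P, with its projections p and q, is the fibre product B x_A C: the map
   (p, q) identifies P with the pairs (b, c) such that f b = g c. *)
Definition is_fibre_product A B C P (f : hom B A) (g : hom C A)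
    (p : hom P B) (q : hom P C) : Prop :=
  (forall x, f (p x) = g (q x)) /\
  (forall b c, f b = g c -> exists! x, p x = b /\ q x = c).

Lemma local_of_res (S : comNzRingType) (c : {rmorphism S -> k}) :
  (forall x, c x != 0 -> is_unit x) -> is_local S.
Proof.
move=> h x y nx ny [z hz].
have x0 : c x = 0 by apply/eqP/negPn/negP => /h.
have y0 : c y = 0 by apply/eqP/negPn/negP => /h.
by move: (congr1 c hz); rewrite rmorphM rmorphD x0 y0 addr0 mulr0 rmorph1
  => /eqP; rewrite eq_sym oner_eq0.
Qed.

(* k as an object of C_R. *)
Lemma kobj_surj (c : k) : exists x, idfun x = c. Proof. by exists c. Qed.
Lemma kobj_local : is_local k.
Proof.
apply: (@local_of_res k idfun) => x x0.
by exists x^-1; rewrite mulVf.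
Qed.
Lemma kobj_artinian : is_artinian k.
Proof.
move=> I idI decI.
have dec m n x : (m <= n)%N -> I n x -> I m x.
  move=> /subnK <-; elim: (n - m)%N => // j IH; rewrite addSn => /decI; exact: IH.
have [[N hN]|h] := pselect (exists N, forall x, I N x -> x = 0).
  exists N => n x _ /hN ->; by have [] := idI n.
exists 0%N => n x _ _.
have [y [Iy y0]] : exists y, I n y /\ y <> 0.
  apply: contrapT => hn; apply: h; exists n => y Iy.
  by apply: contrapT => y0; apply: hn; exists y.
rewrite -[x](mulfVK (x := y)); last exact/eqP.
by have [_ _] := idI n; apply.
Qed.
Definition kobj : art pi :=
  @Art R k pi k pi idfun (fun=> erefl) kobj_surj kobj_local kobj_artinian.

End Homs.

Section SquareZero.
Variable k : fieldType.

(* The trivial extension k + J of k by a square-zero ideal J. *)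
Definition sqz (J : vectType k) : Type := (k * J)%type.

Section Def.
Variable J : vectType k.
HB.instance Definition _ := GRing.Zmodule.copy (sqz J) (k * J)%type.

Definition sqz_one : sqz J := (1, 0).
Definition sqz_mul (x y : sqz J) : sqz J :=
  (x.1 * y.1, x.1 *: y.2 + y.1 *: x.2).

Lemma sqz_mulA : associative sqz_mul.
Proof.
move=> [a x] [b y] [c z]; congr pair; rewrite /= ?mulrA //.
by rewrite !scalerDr !scalerA addrA (mulrC c a) (mulrC c b).
Qed.
Lemma sqz_mulC : commutative sqz_mul.
Proof. by move=> [a x] [b y]; congr pair; [exact: mulrC|exact: addrC]. Qed.
Lemma sqz_mul1 : left_id sqz_one sqz_mul.
Proof. by move=> [a x]; congr pair; rewrite /= ?mul1r // scale1r scaler0 addr0. Qed.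
Lemma sqz_mulDl : left_distributive sqz_mul +%R.
Proof.
move=> [a x] [b y] [c z]; congr pair; rewrite /= ?mulrDl //.
by rewrite scalerDl scalerDr addrACA.
Qed.
Lemma sqz_one_neq0 : sqz_one != 0.
Proof. by apply/eqP => -[/eqP]; rewrite oner_eq0. Qed.
HB.instance Definition _ := GRing.Zmodule_isComNzRing.Build (sqz J)
  sqz_mulA sqz_mulC sqz_mul1 sqz_mulDl sqz_one_neq0.

Definition sqz_in (a : k) : sqz J := (a, 0).
Definition sqz_out (x : sqz J) : k := x.1.

Lemma sqz_in_add : zmod_morphism sqz_in.
Proof. by move=> a b; congr pair; rewrite /= subr0. Qed.
Lemma sqz_in_mul : monoid_morphism sqz_in.
Proof. by split=> // a b; congr pair; rewrite /= !scaler0 addr0. Qed.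
HB.instance Definition _ := GRing.isZmodMorphism.Build k (sqz J) sqz_in sqz_in_add.
HB.instance Definition _ := GRing.isMonoidMorphism.Build k (sqz J) sqz_in sqz_in_mul.

Lemma sqz_out_add : zmod_morphism sqz_out. Proof. by []. Qed.
Lemma sqz_out_mul : monoid_morphism sqz_out. Proof. by []. Qed.
HB.instance Definition _ := GRing.isZmodMorphism.Build (sqz J) k sqz_out sqz_out_add.
HB.instance Definition _ := GRing.isMonoidMorphism.Build (sqz J) k sqz_out sqz_out_mul.

Lemma sqz_out_surj (c : k) : exists x : sqz J, sqz_out x = c.
Proof. by exists (sqz_in c). Qed.

Lemma sqz_unit (x : sqz J) : sqz_out x != 0 -> is_unit x.
Proof.
case: x => a x /= a0; exists (a^-1, - (a^-1 * a^-1) *: x).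
apply: (congr2 pair); rewrite /= ?mulVf // scalerA mulrN mulrA.
by rewrite mulfV // mul1r scaleNr subrr.
Qed.

Lemma sqz_local : is_local (sqz J).
Proof. exact: (@local_of_res k (sqz J) sqz_out sqz_unit). Qed.

Lemma subspace_vspace (W : J -> Prop) :
  W 0 -> (forall a x y, W x -> W y -> W (a *: x + y)) ->
  exists U : {vspace J}, forall x, x \in U <-> W x.
Proof.
move=> W0 WL.
pose Q n := `[< exists U : {vspace J}, \dim U = n /\ forall x, x \in U -> W x >].
have exQ : exists n, Q n.
  exists 0%N; apply/asboolP; exists 0%VS; rewrite dimv0; split=> // x.
  by rewrite memv0 => /eqP ->.
have ubQ n : Q n -> (n <= dim J)%N.
  by move=> /asboolP [U [<- _]]; rewrite -dimvf dimvS ?subvf.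
case: (ex_maxnP exQ ubQ) => n /asboolP [U [dU UW]] maxU.
exists U => x; split=> [/UW //|Wx].
have QS : Q (\dim (U + <[x]>)%VS).
  apply/asboolP; exists (U + <[x]>)%VS; split=> // _ /memv_addP[u uU [_ /vlineP[a ->] ->]].
  by rewrite addrC; apply: WL => //; apply: UW.
have := maxU _ QS; rewrite -dU => le.
have /eqP -> : U == (U + <[x]>)%VS by rewrite eqEdim addvSl le.
by rewrite memvE addvSr.
Qed.

Lemma subspace_dcc (W : nat -> J -> Prop) :
  (forall n, W n 0) -> (forall n a x y, W n x -> W n y -> W n (a *: x + y)) ->
  (forall n x, W n.+1 x -> W n x) ->
  exists N, forall n x, (N <= n)%N -> W N x -> W n x.
Proof.
move=> W0 WL decW.
have dec m n x : (m <= n)%N -> W n x -> W m x.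
  move=> /subnK <-; elim: (n - m)%N => // j IH; rewrite addSn => /decW; exact: IH.
have exU n : exists U : {vspace J}, forall x, x \in U <-> W n x.
  exact: subspace_vspace (W0 n) (WL n).
pose Q d := `[< exists n (U : {vspace J}), \dim U = d /\ forall x, x \in U <-> W n x >].
have exQ : exists d, Q d.
  by have [U hU] := exU 0%N; exists (\dim U); apply/asboolP; exists 0%N, U.
case: (ex_minnP exQ) => d /asboolP [N [U [dU hU]]] minQ.
exists N => n x le_Nn Wx; have [U' hU'] := exU n.
have sU : (U' <= U)%VS.
  by apply/subvP => y /hU' /(dec _ _ _ le_Nn) /hU.
have : (d <= \dim U')%N by apply: minQ; apply/asboolP; exists n, U'.
rewrite -dU => le; have /eqP eU : U' == U by rewrite eqEdim sU.
by apply/hU'; rewrite eU; apply/hU.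
Qed.

Lemma sqz_artinian : is_artinian (sqz J).
Proof.
move=> I idI decI.
have dec m n x : (m <= n)%N -> I n x -> I m x.
  move=> /subnK <-; elim: (n - m)%N => // j IH; rewrite addSn => /decI; exact: IH.
have [[N hN]|h] := pselect (exists N, forall x, I N x -> sqz_out x = 0); last first.
  exists 0%N => n x _ _.
  have [y [Iy y0]] : exists y, I n y /\ sqz_out y <> 0.
    apply: contrapT => hn; apply: h; exists n => y Iy.
    by apply: contrapT => y0; apply: hn; exists y.
  have [z zy] : is_unit y by apply: sqz_unit; apply/eqP.
  rewrite -[x]mulr1 -zy mulrA.
  by have [_ _] := idI n; apply.
have [N' hN'] : exists N', forall n x, (N' <= n)%N ->
    I N' (0, x) -> I n (0, x).
  apply: (@subspace_dcc (fun n x => I n (0, x))) => [n|n a x y Ix Iy|n x].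
  - by have [] := idI n.
  - have [_ ID IM] := idI n.
    have -> : (0, a *: x + y) = sqz_in a * (0, x) + (0, y) :> sqz J.
      by apply: (congr2 pair); rewrite /= ?mulr0 ?addr0 // scale0r addr0.
    exact: ID (IM _ _ Ix) Iy.
  - exact: decI.
exists (maxn N N') => n x; rewrite geq_max => /andP[le1 le2] Ix.
have x0 : sqz_out x = 0 by apply: hN; apply: dec Ix; rewrite leq_maxl.
case: x x0 Ix => a x /= -> Ix; apply: hN' => //.
by apply: dec Ix; rewrite leq_maxr.
Qed.
End Def.

Section Map.
Variables (J J' : vectType k) (u : {linear J -> J'}).
Definition sqz_map (x : sqz J) : sqz J' := (x.1, u x.2).
Lemma sqz_map_add : zmod_morphism sqz_map.
Proof. by move=> a b; congr pair; rewrite /= linearB. Qed.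
Lemma sqz_map_mul : monoid_morphism sqz_map.
Proof.
by split=> [|a b]; congr pair; rewrite /= ?linear0 // linearD !linearZ.
Qed.
HB.instance Definition _ :=
  GRing.isZmodMorphism.Build (sqz J) (sqz J') sqz_map sqz_map_add.
HB.instance Definition _ :=
  GRing.isMonoidMorphism.Build (sqz J) (sqz J') sqz_map sqz_map_mul.
End Map.

End SquareZero.

Section SquareZeroObjects.
Variables (R : comNzRingType) (k : fieldType) (pi : {rmorphism R -> k}).

Definition sqzobj (J : vectType k) : art pi :=
  @Art R k pi (sqz J) (@sqz_in k J \o pi) (@sqz_out k J)
    (fun=> erefl) (@sqz_out_surj k J) (@sqz_local k J) (@sqz_artinian k J).

Lemma hsqz_str (J J' : vectType k) (u : {linear J -> J'}) r :
  sqz_map u (art_str (sqzobj J) r) = art_str (sqzobj J') r.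
Proof. by congr pair; rewrite /= linear0. Qed.
Definition hsqz (J J' : vectType k) (u : {linear J -> J'}) :
    hom (sqzobj J) (sqzobj J') :=
  @Hom R k pi (sqzobj J) (sqzobj J') (@sqz_map k J J' u) (hsqz_str u)
    (fun=> erefl).

Definition hsqz_in (J : vectType k) : hom (kobj pi) (sqzobj J) :=
  @Hom R k pi (kobj pi) (sqzobj J) (@sqz_in k J) (fun=> erefl) (fun=> erefl).
Definition hsqz_out (J : vectType k) : hom (sqzobj J) (kobj pi) :=
  @Hom R k pi (sqzobj J) (kobj pi) (@sqz_out k J) (fun=> erefl) (fun=> erefl).

(* The pair (a, b) is the dual number a + b epsilon. *)
Definition dual : art pi := sqzobj k^o.

End SquareZeroObjects.

(* Functors F : C_R -> Set with F(k) a point.  Equality of morphisms in C_R is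
   equality of the underlying maps, whence fmap_ext. *)
Record functor (R : comNzRingType) (k : fieldType) (pi : {rmorphism R -> k}) := Functor {
  fobj :> art pi -> Type;
  fmap : forall A B, hom A B -> fobj A -> fobj B;
  fmap_ext : forall A B (f g : hom A B), f =1 g -> fmap f =1 fmap g;
  fmap_id : forall A x, fmap (hid A) x = x;
  fmap_comp : forall A B C (g : hom B C) (f : hom A B) x,
    fmap (hcomp g f) x = fmap g (fmap f x);
  fpt : fobj (kobj pi);
  fpt_uniq : forall x, x = fpt }.

Arguments fmap {R k pi} f0 {A B} f x.
Arguments fmap_ext {R k pi} f0 {A B} f g.
Arguments fmap_id {R k pi} f0 {A} x.
Arguments fmap_comp {R k pi} f0 {A B C} g f x.
Arguments fpt {R k pi} f0.
Arguments fpt_uniq {R k pi} f0 x.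

Section Functors.
Variables (R : comNzRingType) (k : fieldType) (pi : {rmorphism R -> k}).
Implicit Types (F G : functor pi) (A B C P : art pi).

Definition smooth F : Prop :=
  forall A B (f : hom B A), hsurj f -> forall x, exists y, fmap F f y = x.

(* Surjectivity and injectivity of eta : F(P) -> F(B) x_{F(A)} F(C), for
   P = B x_A C with projections p and q. *)
Definition eta_surjective F A B C P (f : hom B A) (g : hom C A)
    (p : hom P B) (q : hom P C) : Prop :=
  forall b c, fmap F f b = fmap F g c ->
  exists w, fmap F p w = b /\ fmap F q w = c.

Definition eta_injective F B C P (p : hom P B) (q : hom P C) : Prop :=
  forall w w', fmap F p w = fmap F p w' -> fmap F q w = fmap F q w' -> w = w'.

Definition homogeneous F : Prop :=
  forall A B C P (f : hom B A) (g : hom C A) (p : hom P B) (q : hom P C),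
  is_fibre_product f g p q -> hsurj f ->
  eta_surjective F f g p q /\ eta_injective F p q.

(* The case A = k. *)
Definition pointwise_homogeneous F : Prop :=
  forall B C P (f : hom B (kobj pi)) (g : hom C (kobj pi))
    (p : hom P B) (q : hom P C),
  is_fibre_product f g p q -> hsurj f ->
  eta_surjective F f g p q /\ eta_injective F p q.

Definition deformation_functor F : Prop :=
  (forall A B C P (f : hom B A) (g : hom C A) (p : hom P B) (q : hom P C),
    is_fibre_product f g p q -> hsurj f -> eta_surjective F f g p q) /\
  pointwise_homogeneous F.

Lemma homogeneous_pointwise F : homogeneous F -> pointwise_homogeneous F.
Proof. by move=> h B C P f g p q; apply: h. Qed.

Lemma deformation_pointwise F : deformation_functor F -> pointwise_homogeneous F.
Proof. by case. Qed.

Lemma sqz_fibre_product (J1 J2 : vectType k) :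
  is_fibre_product (hsqz_out pi J1) (hsqz_out pi J2)
    (hsqz pi (fst : {linear (J1 * J2)%type -> J1}))
    (hsqz pi (snd : {linear (J1 * J2)%type -> J2})).
Proof.
split=> [x //|[a x] [b y] /= ab]; rewrite /sqz_out /= in ab; rewrite -{}ab.
exists ((a, (x, y)) : sqz _); split=> [//|[c [x' y']] /=].
by rewrite /sqz_map /= => -[[-> ->] [->]].
Qed.

End Functors.

(* The k-vector space structure on t_F = F(k[eps]).  The fibre product
   k[eps] x_k k[eps] is k + k^2; addition is the inverse of the bijection
   F(k + k^2) -> F(k[eps]) x F(k[eps]) followed by the map F(k + k^2) -> F(k[eps])
   induced by the sum k^2 -> k, and a in k acts by F(eps |-> a eps). *)
Section Tangent.
Variables (R : comNzRingType) (k : fieldType) (pi : {rmorphism R -> k}).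
Variables (F : functor pi) (hF : pointwise_homogeneous F).

Definition lact (J J' : vectType k) (u : {linear J -> J'}) :
  F (sqzobj pi J) -> F (sqzobj pi J') := fmap F (hsqz pi u).

Lemma lact_ext (J J' : vectType k) (u v : {linear J -> J'}) :
  u =1 v -> lact u =1 lact v.
Proof. by move=> uv; apply: fmap_ext => x; rewrite /= /sqz_map uv. Qed.

Lemma lact_comp (J J' J'' : vectType k) (v : {linear J' -> J''})
  (u : {linear J -> J'}) x : lact v (lact u x) = lact (v \o u) x.
Proof. by rewrite /lact -fmap_comp; apply: fmap_ext. Qed.

Lemma lact_id (J : vectType k) x : lact (idfun : {linear J -> J}) x = x.
Proof.
by rewrite /lact -[RHS](fmap_id F); apply: fmap_ext => -[a y].
Qed.

Lemma tpair_ex (J1 J2 : vectType k) (x : F (sqzobj pi J1)) (y : F (sqzobj pi J2)) :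
  exists w : F (sqzobj pi (J1 * J2)%type),
    lact (fst : {linear (J1 * J2)%type -> J1}) w = x /\
    lact (snd : {linear (J1 * J2)%type -> J2}) w = y.
Proof.
have [eS _] := hF (sqz_fibre_product pi J1 J2) (@sqz_out_surj k J1).
by apply: eS; rewrite [LHS]fpt_uniq [RHS]fpt_uniq.
Qed.

Definition tpair (J1 J2 : vectType k) (x : F (sqzobj pi J1)) (y : F (sqzobj pi J2)) :=
  projT1 (cid (tpair_ex x y)).

Lemma tpair1 (J1 J2 : vectType k) (x : F (sqzobj pi J1)) (y : F (sqzobj pi J2)) :
  lact (fst : {linear (J1 * J2)%type -> J1}) (tpair x y) = x.
Proof. by rewrite /tpair; case: cid => w /= []. Qed.

Lemma tpair2 (J1 J2 : vectType k) (x : F (sqzobj pi J1)) (y : F (sqzobj pi J2)) :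
  lact (snd : {linear (J1 * J2)%type -> J2}) (tpair x y) = y.
Proof. by rewrite /tpair; case: cid => w /= []. Qed.

Lemma tpair_uniq (J1 J2 : vectType k) (w w' : F (sqzobj pi (J1 * J2)%type)) :
  lact (fst : {linear (J1 * J2)%type -> J1}) w = lact fst w' ->
  lact (snd : {linear (J1 * J2)%type -> J2}) w = lact snd w' -> w = w'.
Proof.
have [_ eI] := hF (sqz_fibre_product pi J1 J2) (@sqz_out_surj k J1).
exact: eI.
Qed.

Definition tangent of pointwise_homogeneous F : Type := F (dual pi).
Local Notation T := (tangent hF).

Definition tzero : T := fmap F (hsqz_in pi k^o) (fpt F).
Definition tadd (x y : T) : T :=
  lact (fst \+ snd : {linear (k^o * k^o)%type -> k^o}) (tpair x y).
Definition tscale (a : k) (x : T) : T :=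
  lact ( *:%R a : {linear k^o -> k^o}) x.
Definition topp (x : T) : T := tscale (- 1) x.

Lemma lact_add (J : vectType k) (u v : {linear J -> k^o}) t :
  tadd (lact u t) (lact v t) = lact (u \+ v : {linear J -> k^o}) t.
Proof.
pose w (x : J) : (k^o * k^o)%type := (u x, v x).
have wL : linear w by move=> a x y; rewrite /w !linearP.
pose wM := GRing.isLinear.Build k J (k^o * k^o)%type *:%R w wL.
pose W : {linear J -> (k^o * k^o)%type} := HB.pack w wM.
rewrite /tadd; have -> : tpair (lact u t) (lact v t) = lact W t.
  by apply: tpair_uniq; rewrite ?tpair1 ?tpair2 lact_comp; apply: lact_ext.
by rewrite lact_comp; apply: lact_ext.
Qed.

Lemma lact_0 (J : vectType k) t : lact (\0 : {linear J -> k^o}) t = tzero.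
Proof.
rewrite /tzero -(fpt_uniq F (fmap F (hsqz_out pi J) t)) -fmap_comp.
by apply: fmap_ext.
Qed.

Lemma lact_scale (J : vectType k) a (u : {linear J -> k^o}) t :
  tscale a (lact u t) = lact (a \*: u : {linear J -> k^o}) t.
Proof. by rewrite /tscale lact_comp; apply: lact_ext. Qed.

Lemma taddA : associative tadd.
Proof.
move=> x y z; pose t := tpair x (tpair y z).
pose p1 : {linear (k^o * (k^o * k^o))%type -> k^o} := fst.
pose p2 : {linear (k^o * (k^o * k^o))%type -> k^o} := fst \o snd.
pose p3 : {linear (k^o * (k^o * k^o))%type -> k^o} := snd \o snd.
have <- : lact p1 t = x by rewrite tpair1.
have <- : lact p2 t = y by rewrite -lact_comp tpair2 tpair1.
have <- : lact p3 t = z by rewrite -lact_comp tpair2 tpair2.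
by rewrite !lact_add; apply: lact_ext => c /=; rewrite addrA.
Qed.

Lemma taddC : commutative tadd.
Proof.
move=> x y; pose t := tpair x y.
have <- : lact fst t = x by rewrite tpair1.
have <- : lact snd t = y by rewrite tpair2.
by rewrite !lact_add; apply: lact_ext => c /=; rewrite addrC.
Qed.

Lemma tadd0 : left_id tzero tadd.
Proof.
move=> x; rewrite -{2}(lact_id x) -(lact_0 x) -{2}(lact_id x) lact_add.
by apply: lact_ext => c /=; rewrite add0r.
Qed.

Lemma taddN : left_inverse tzero topp tadd.
Proof.
move=> x; rewrite -(lact_0 x) -{2}(lact_id x) lact_add.
by apply: lact_ext => c /=; rewrite scaleN1r addNr.
Qed.

HB.instance Definition _ := gen_eqMixin T.
HB.instance Definition _ := gen_choiceMixin T.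
HB.instance Definition _ := GRing.isZmodule.Build T taddA taddC tadd0 taddN.

Lemma tscaleA a b x : tscale a (tscale b x) = tscale (a * b) x.
Proof. by rewrite /tscale lact_comp; apply: lact_ext => c /=; rewrite scalerA. Qed.
Lemma tscale1 : left_id 1 tscale.
Proof.
by move=> x; rewrite -{2}(lact_id x); apply: lact_ext => c /=; rewrite scale1r.
Qed.
Lemma tscaleDr : right_distributive tscale +%R.
Proof.
move=> a x y; pose t := tpair x y.
have <- : lact fst t = x by rewrite tpair1.
have <- : lact snd t = y by rewrite tpair2.
change (tscale a (tadd (lact fst t) (lact snd t)) =
  tadd (tscale a (lact fst t)) (tscale a (lact snd t))).
rewrite lact_add !lact_scale lact_add.
by apply: lact_ext => c /=; rewrite scalerDr.
Qed.
Lemma tscaleDl x : {morph tscale^~ x : a b / a + b}.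
Proof.
move=> a b; change (tscale (a + b) x = tadd (tscale a x) (tscale b x)).
rewrite /tscale lact_add.
by apply: lact_ext => c /=; rewrite scalerDl.
Qed.
HB.instance Definition _ := GRing.Zmodule_isLmodule.Build k T
  tscaleA tscale1 tscaleDr tscaleDl.

End Tangent.

Arguments tangent {R k pi F} _.

(* A map on points which is natural for the maps k + J -> k + J' is linear. *)
Section TangentMap.
Variables (R : comNzRingType) (k : fieldType) (pi : {rmorphism R -> k}).
Variables (F G : functor pi).
Variables (hF : pointwise_homogeneous F) (hG : pointwise_homogeneous G).
Variable phi : forall J : vectType k, F (sqzobj pi J) -> G (sqzobj pi J).
Hypothesis phi_nat : forall (J J' : vectType k) (u : {linear J -> J'}) x,
  phi (lact u x) = lact u (phi x).

Lemma tangent_map_linear :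
  linear (phi (J := k^o) : tangent hF -> tangent hG).
Proof.
move=> a x y; pose t := tpair hF x y.
have ex : lact fst t = x by rewrite tpair1.
have ey : lact snd t = y by rewrite tpair2.
rewrite -ex -ey.
change (phi (tadd (hF := hF) (tscale (hF := hF) a (lact fst t)) (lact snd t)) =
  tadd (hF := hG) (tscale (hF := hG) a (phi (lact fst t))) (phi (lact snd t))).
by rewrite !lact_scale !lact_add !phi_nat lact_scale lact_add.
Qed.
End TangentMap.

(* The formal sums of pairs v (x) j, modulo the relations of the tensor
   product over k; the quotient is the abelian group V (x)_k J. *)
Section Tensor.
Variables (k : fieldType) (V J : lmodType k).

Inductive tensor_rel : seq (V * J) -> seq (V * J) -> Prop :=
| tensor_refl s : tensor_rel s s
| tensor_sym s t : tensor_rel s t -> tensor_rel t s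
| tensor_trans s t u : tensor_rel s t -> tensor_rel t u -> tensor_rel s u
| tensor_cat s s' t t' :
    tensor_rel s s' -> tensor_rel t t' -> tensor_rel (s ++ t) (s' ++ t')
| tensor_comm s t : tensor_rel (s ++ t) (t ++ s)
| tensor_zero j : tensor_rel [:: (0, j)] [::]
| tensor_addl v v' j : tensor_rel [:: (v + v', j)] [:: (v, j); (v', j)]
| tensor_addr v j j' : tensor_rel [:: (v, j + j')] [:: (v, j); (v, j')]
| tensor_scale a v j : tensor_rel [:: (a *: v, j)] [:: (v, a *: j)].

Definition tensor_relb : rel (seq (V * J)) := fun s t => `[< tensor_rel s t >].

Lemma tensor_relb_equiv : equiv_class_of tensor_relb.
Proof.
split=> [s|s t|t s u].
- exact/asboolP/tensor_refl.
- by apply/asboolP/asboolP; apply: tensor_sym.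
- by move=> /asboolP st /asboolP tu; apply/asboolP; apply: tensor_trans tu.
Qed.
Canonical tensor_equiv := EquivRelPack tensor_relb_equiv.

Definition tensor := {eq_quot tensor_relb}.
HB.instance Definition _ := Choice.on tensor.
HB.instance Definition _ : EqQuotient (seq (V * J)) tensor_relb tensor :=
  EqQuotient.on tensor.

Definition tensor0 : tensor := \pi_tensor [::].

End Tensor.

(* id_V (x) u. *)
Definition tensor_map (k : fieldType) (V J J' : lmodType k)
    (u : {linear J -> J'}) (t : tensor V J) : tensor V J' :=
  \pi_(tensor V J') [seq (x.1, u x.2) | x <- repr t].

Section Obstructions.
Variables (R : comNzRingType) (k : fieldType) (pi : {rmorphism R -> k}).

(* 0 -> J -> A -> B -> 0 with m_A J = 0.  The last field says both that m_A
   kills J and that the vector space structure of J is the induced one. *)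
Record small_ext := SmallExt {
  se_src : art pi;
  se_tgt : art pi;
  se_ker : lmodType k;
  se_inc : {additive se_ker -> se_src};
  se_hom : hom se_src se_tgt;
  se_inc_inj : injective se_inc;
  se_exact : forall x, se_hom x = 0 <-> exists j, x = se_inc j;
  se_surj : hsurj se_hom;
  se_scale : forall x j, x * se_inc j = se_inc (art_res se_src x *: j) }.

Record small_ext_mor (e e' : small_ext) := SmallExtMor {
  sem_src : hom (se_src e) (se_src e');
  sem_tgt : hom (se_tgt e) (se_tgt e');
  sem_ker : {linear se_ker e -> se_ker e'};
  sem_comm_inc : forall j, sem_src (se_inc e j) = se_inc e' (sem_ker j);
  sem_comm_hom : forall x, sem_tgt (se_hom e x) = se_hom e' (sem_src x) }.

Definition lifts (F : functor pi) (e : small_ext) (x : F (se_tgt e)) : Prop :=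
  exists y, fmap F (se_hom e) y = x.

Record obstruction_theory (F : functor pi) (V : lmodType k) := ObstructionTheory {
  ob_map :> forall e : small_ext, F (se_tgt e) -> tensor V (se_ker e);
  ob_lifts : forall e (x : F (se_tgt e)), lifts x -> ob_map x = tensor0 V (se_ker e);
  ob_nat : forall e e' (a : small_ext_mor e e') (x : F (se_tgt e)),
    tensor_map (sem_ker a) (ob_map x) = ob_map (fmap F (sem_tgt a) x) }.

Arguments ob_map {F V} o e x.

Definition complete_obstruction_theory (F : functor pi) (V : lmodType k)
    (v : obstruction_theory F V) : Prop :=
  forall e (x : F (se_tgt e)), v e x = tensor0 V (se_ker e) -> lifts x.

Definition complete_obstruction_space (F : functor pi) (V : lmodType k) : Prop :=
  exists v : obstruction_theory F V, complete_obstruction_theory v.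

End Obstructions.

Definition linear_iso (k : fieldType) (U V : lmodType k) : Prop :=
  exists f : {linear U -> V}, bijective f.

(* E^n = sdc_fun n, and sdc_d n i, sdc_s n i are the maps d^i : E^n -> E^(n+1)
   and s^i : E^(n+1) -> E^n.  They are present for every natural number i, but
   only d^i for 1 <= i <= n and s^i for 0 <= i <= n carry any meaning. *)
Record sdc (R : comNzRingType) (k : fieldType) (pi : {rmorphism R -> k}) := SDC {
  sdc_fun :> nat -> functor pi;
  sdc_smooth : forall n, smooth (sdc_fun n);
  sdc_homogeneous : forall n, homogeneous (sdc_fun n);
  sdc_d : forall n (i : nat) A, sdc_fun n A -> sdc_fun n.+1 A;
  sdc_s : forall n (i : nat) A, sdc_fun n.+1 A -> sdc_fun n A;
  sdc_mul : forall m n A, sdc_fun m A -> sdc_fun n A -> sdc_fun (m + n) A;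
  sdc_one : forall A, sdc_fun 0 A;

  sdc_d_nat : forall n i A B (f : hom A B) x, (1 <= i <= n)%N ->
    fmap (sdc_fun n.+1) f (sdc_d i x) = sdc_d i (fmap (sdc_fun n) f x);
  sdc_s_nat : forall n i A B (f : hom A B) x, (i <= n)%N ->
    fmap (sdc_fun n) f (sdc_s i x) = sdc_s i (fmap (sdc_fun n.+1) f x);
  sdc_mul_nat : forall m n A B (f : hom A B) x y,
    fmap (sdc_fun (m + n)) f (sdc_mul x y) =
    sdc_mul (fmap (sdc_fun m) f x) (fmap (sdc_fun n) f y);
  sdc_one_nat : forall A B (f : hom A B),
    fmap (sdc_fun 0) f (sdc_one A) = sdc_one B;

  sdc_mulA : forall m n p A (x : sdc_fun m A) (y : sdc_fun n A) (z : sdc_fun p A),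
    sdc_mul (sdc_mul x y) z =
    ecast j (sdc_fun j A) (addnA m n p) (sdc_mul x (sdc_mul y z));
  sdc_mul1 : forall n A (x : sdc_fun n A), sdc_mul (sdc_one A) x = x;
  sdc_mulr1 : forall n A (x : sdc_fun n A),
    ecast j (sdc_fun j A) (addn0 n) (sdc_mul x (sdc_one A)) = x;

  sdc_dd : forall n i j A (x : sdc_fun n A),
    (1 <= i)%N -> (i < j)%N -> (j <= n.+1)%N ->
    sdc_d j (sdc_d i x) = sdc_d i (sdc_d j.-1 x);
  sdc_ss : forall n i j A (x : sdc_fun n.+2 A), (i <= j)%N -> (j <= n)%N ->
    sdc_s j (sdc_s i x) = sdc_s i (sdc_s j.+1 x);
  sdc_sd_lt : forall n i j A (x : sdc_fun n.+1 A),
    (1 <= i)%N -> (i < j)%N -> (j <= n.+1)%N ->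
    sdc_s j (sdc_d i x) = sdc_d i (sdc_s j.-1 x);
  sdc_sd_id : forall n i j A (x : sdc_fun n A),
    (1 <= i <= n)%N -> (j <= n)%N -> (i == j) || (i == j.+1) ->
    sdc_s j (sdc_d i x) = x;
  sdc_sd_gt : forall n i j A (x : sdc_fun n.+1 A),
    (j.+1 < i)%N -> (i <= n.+1)%N ->
    sdc_s j (sdc_d i x) = sdc_d i.-1 (sdc_s j x);

  sdc_d_mul : forall m n i A (x : sdc_fun m A) (y : sdc_fun n A),
    (1 <= i <= m)%N -> sdc_mul (sdc_d i x) y = sdc_d i (sdc_mul x y);
  sdc_mul_d : forall m n i A (x : sdc_fun m A) (y : sdc_fun n A),
    (1 <= i <= n)%N ->
    ecast j (sdc_fun j A) (addnS m n) (sdc_mul x (sdc_d i y)) =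
    sdc_d (i + m) (sdc_mul x y);
  sdc_s_mul : forall m n i A (x : sdc_fun m.+1 A) (y : sdc_fun n A),
    (i <= m)%N ->
    sdc_mul (sdc_s i x) y = sdc_s i (sdc_mul x y : sdc_fun (m + n).+1 A);
  sdc_mul_s : forall m n i A (x : sdc_fun m A) (y : sdc_fun n.+1 A),
    (i <= n)%N ->
    sdc_mul x (sdc_s i y) =
    sdc_s (i + m) (ecast j (sdc_fun j A) (addnS m n) (sdc_mul x y)) }.

Section Cohomology.
Variables (R : comNzRingType) (k : fieldType) (pi : {rmorphism R -> k}).
Variable E : sdc pi.

Definition cochain (n : nat) : lmodType k :=
  tangent (homogeneous_pointwise (sdc_homogeneous E n)).

Definition omega0 (J : vectType k) : E 1 (sqzobj pi J) :=
  fmap (E 1) (hsqz_in pi J) (fpt (E 1)).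

(* The coface maps E^n -> E^(n+1) for 0 <= i <= n+1, on the k-algebras k + J. *)
Definition coface n (i : nat) (J : vectType k) (x : E n (sqzobj pi J)) :
    E n.+1 (sqzobj pi J) :=
  if i == 0%N then sdc_mul (omega0 J) x
  else if i == n.+1 then
    ecast j (E j (sqzobj pi J)) (addn1 n) (sdc_mul x (omega0 J))
  else sdc_d i x.

Lemma fmap_ecast m n (e : m = n) A B (f : hom A B) (x : E m A) :
  fmap (E n) f (ecast j (E j A) e x) = ecast j (E j B) e (fmap (E m) f x).
Proof. by case: n / e. Qed.

Lemma omega0_nat (J J' : vectType k) (u : {linear J -> J'}) :
  lact u (omega0 J) = omega0 J'.
Proof.
rewrite /omega0 /lact -fmap_comp; apply: fmap_ext => a.
by rewrite /= /sqz_map /= linear0.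
Qed.

Lemma coface_nat n i (J J' : vectType k) (u : {linear J -> J'})
  (x : E n (sqzobj pi J)) : (i <= n.+1)%N ->
  coface i (lact u x) = lact u (coface i x).
Proof.
rewrite /coface leq_eqVlt; case: (i =P 0%N) => [_ _|i0].
  rewrite -(omega0_nat u); apply/esym.
  exact: (@sdc_mul_nat _ _ _ E 1 n _ _ (hsqz pi u) (omega0 J) x).
case: eqP => [_ _|_ /= le_in].
  by rewrite -(omega0_nat u) /lact fmap_ecast sdc_mul_nat.
by rewrite /lact sdc_d_nat // lt0n; apply/andP; split=> //; apply/eqP.
Qed.

Definition diff n (x : cochain n) : cochain n.+1 :=
  \sum_(i < n.+2) (-1) ^+ i *: (coface i x : cochain n.+1).

Lemma diff_linear n : linear (@diff n).
Proof.
move=> a x y; rewrite /diff scaler_sumr -big_split /=; apply: eq_bigr => i _.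
have le_in : (i <= n.+1)%N by rewrite -ltnS.
have L := @tangent_map_linear _ _ _ (E n) (E n.+1)
  (homogeneous_pointwise (sdc_homogeneous E n))
  (homogeneous_pointwise (sdc_homogeneous E n.+1))
  (fun J => @coface n i J) (fun J J' u z => coface_nat u z le_in).
by rewrite L scalerDr !scalerA (mulrC a).
Qed.
HB.instance Definition _ n :=
  GRing.isLinear.Build k (cochain n) (cochain n.+1) _ (@diff n) (@diff_linear n).

Definition is_cocycle n : {pred cochain n} := [pred x | diff x == 0].

Lemma is_cocycle_submod n : submod_closed (@is_cocycle n).
Proof.
split=> [|a x y]; rewrite !inE ?linear0 // => /eqP x0 /eqP y0.
by rewrite linearP /= x0 y0 scaler0 addr0.
Qed.
HB.instance Definition _ n :=
  GRing.isSubmodClosed.Build k (cochain n) (@is_cocycle n) (@is_cocycle_submod n).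

Record cocycle n := Cocycle { cocycle_val : cochain n; _ : cocycle_val \in @is_cocycle n }.
HB.instance Definition _ n := [isSub for @cocycle_val n].
HB.instance Definition _ n := [Choice of cocycle n by <:].
HB.instance Definition _ n := [SubChoice_isSubLmodule of cocycle n by <:].

Lemma cocycle_valP n a (x y : cocycle n) :
  cocycle_val (a *: x + y) = a *: cocycle_val x + cocycle_val y.
Proof. exact: (linearP (\val : {linear cocycle n -> cochain n})). Qed.

Definition is_coboundary n : cochain n -> Prop :=
  if n is m.+1 then fun x => exists y : cochain m, x = diff y else fun x => x = 0.

Definition coboundary n : {pred cocycle n} := fun z => `[< is_coboundary (cocycle_val z) >].

Lemma coboundary_submod n : submod_closed (@coboundary n).
Proof.
case: n => [|n]; split=> [|a x y].
- exact/asboolP.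
- move=> /asboolP hx /asboolP hy; apply/asboolP.
  by rewrite /is_coboundary cocycle_valP (hx : cocycle_val x = 0)
    (hy : cocycle_val y = 0) scaler0 addr0.
- by apply/asboolP; exists 0; rewrite linear0.
- move=> /asboolP [x' hx] /asboolP [y' hy]; apply/asboolP.
  exists (a *: x' + y'); rewrite linearP /= -hx -hy; exact: cocycle_valP.
Qed.
HB.instance Definition _ n :=
  GRing.isSubmodClosed.Build k (cocycle n) (@coboundary n) (@coboundary_submod n).

Definition cohomology n : Type := Quotient.quot (@coboundary n).
HB.instance Definition _ n := GRing.Zmodule.on (cohomology n).

Section Scale.
Variable n : nat.
Local Notation H := (cohomology n).

Definition cohomology_class (z : cocycle n) : H := \pi_(Quotient.quot (@coboundary n)) z.

Lemma cohomology_classP x y :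
  cohomology_class x = cohomology_class y <-> is_coboundary (cocycle_val (x - y)).
Proof.
split=> [/eqP|h]; first by rewrite eqquotE => /asboolP.
by apply/eqP; rewrite eqquotE; apply/asboolP.
Qed.

Lemma cohomology_classD : {morph cohomology_class : x y / x + y}.
Proof. by move=> x y; rewrite /cohomology_class raddfD. Qed.

Lemma cohomology_class_surj (c : H) : exists z, cohomology_class z = c.
Proof. by exists (repr (c : Quotient.quot (@coboundary n))); exact: reprK. Qed.

Definition cohomology_scale (a : k) (c : H) : H :=
  cohomology_class (a *: repr (c : Quotient.quot (@coboundary n))).

Lemma cohomology_scale_class a z :
  cohomology_scale a (cohomology_class z) = cohomology_class (a *: z).
Proof.
apply/cohomology_classP; rewrite -scalerBr; apply/asboolP.
have h : is_coboundary (cocycle_val (repr (cohomology_class z : Quotient.quot (@coboundary n)) - z)).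
  by apply/cohomology_classP; exact: reprK.
exact: (rpredZ a (asboolT h : _ \in @coboundary n)).
Qed.

Lemma cohomology_scaleA a b c :
  cohomology_scale a (cohomology_scale b c) = cohomology_scale (a * b) c.
Proof.
by have [z <-] := cohomology_class_surj c; rewrite !cohomology_scale_class scalerA.
Qed.
Lemma cohomology_scale1 : left_id 1 cohomology_scale.
Proof.
by move=> c; have [z <-] := cohomology_class_surj c;
  rewrite cohomology_scale_class scale1r.
Qed.
Lemma cohomology_scaleDr : right_distributive cohomology_scale +%R.
Proof.
move=> a c d; have [z <-] := cohomology_class_surj c.
have [t <-] := cohomology_class_surj d.
by rewrite -cohomology_classD !cohomology_scale_class scalerDr cohomology_classD.
Qed.
Lemma cohomology_scaleDl c : {morph cohomology_scale^~ c : a b / a + b}.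
Proof.
move=> a b; have [z <-] := cohomology_class_surj c.
by rewrite !cohomology_scale_class scalerDl cohomology_classD.
Qed.
HB.instance Definition _ := GRing.Zmodule_isLmodule.Build k H
  cohomology_scaleA cohomology_scale1 cohomology_scaleDr cohomology_scaleDl.
End Scale.

End Cohomology.

Section MaurerCartan.
Variables (R : comNzRingType) (k : fieldType) (pi : {rmorphism R -> k}).
Variable E : sdc pi.
Implicit Types A B C : art pi.

Definition mul00 A (x y : E 0 A) : E 0 A := sdc_mul x y.
Definition mul01 A (x : E 0 A) (y : E 1 A) : E 1 A := sdc_mul x y.
Definition mul10 A (x : E 1 A) (y : E 0 A) : E 1 A := sdc_mul x y.
Definition mul11 A (x y : E 1 A) : E 2 A := sdc_mul x y.

(* g * w * g^-1 = w'.  Here g^-1 is the inverse of g in the monoid E^0(A), the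
   element h with g * h = h * g = 1; it is unique, and exists for every g by a
   consequence of the axioms. *)
Definition conjugates A (g : E 0 A) (w w' : E 1 A) : Prop :=
  exists h : E 0 A,
    [/\ mul00 g h = sdc_one E A, mul00 h g = sdc_one E A &
        mul10 (mul01 g w) h = w'].

Definition is_mc A (w : E 1 A) : Prop := mul11 w w = sdc_d 1 w.

Definition mc A : Type := {w : E 1 A | is_mc w}.
HB.instance Definition _ A := gen_eqMixin (mc A).
HB.instance Definition _ A := gen_choiceMixin (mc A).

Definition gauge_equiv A (w w' : mc A) : Prop :=
  exists g : E 0 A, conjugates g (sval w) (sval w').

Lemma mulA000 A (x y z : E 0 A) : mul00 (mul00 x y) z = mul00 x (mul00 y z).
Proof. by have := sdc_mulA x y z; rewrite (eq_irrelevance (addnA 0 0 0) erefl). Qed.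
Lemma mulA001 A (x y : E 0 A) (z : E 1 A) :
  mul01 (mul00 x y) z = mul01 x (mul01 y z).
Proof. by have := sdc_mulA x y z; rewrite (eq_irrelevance (addnA 0 0 1) erefl). Qed.
Lemma mulA010 A (x : E 0 A) (y : E 1 A) (z : E 0 A) :
  mul10 (mul01 x y) z = mul01 x (mul10 y z).
Proof. by have := sdc_mulA x y z; rewrite (eq_irrelevance (addnA 0 1 0) erefl). Qed.
Lemma mulA100 A (x : E 1 A) (y z : E 0 A) :
  mul10 (mul10 x y) z = mul10 x (mul00 y z).
Proof. by have := sdc_mulA x y z; rewrite (eq_irrelevance (addnA 1 0 0) erefl). Qed.
Lemma mul1_00 A (x : E 0 A) : mul00 (sdc_one E A) x = x.
Proof. exact: sdc_mul1. Qed.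
Lemma mul1_01 A (x : E 1 A) : mul01 (sdc_one E A) x = x.
Proof. exact: sdc_mul1. Qed.
Lemma mulr1_00 A (x : E 0 A) : mul00 x (sdc_one E A) = x.
Proof. by have := sdc_mulr1 x; rewrite (eq_irrelevance (addn0 0) erefl). Qed.
Lemma mulr1_10 A (x : E 1 A) : mul10 x (sdc_one E A) = x.
Proof. by have := sdc_mulr1 x; rewrite (eq_irrelevance (addn0 1) erefl). Qed.

Lemma conjugates_one A (w : E 1 A) : conjugates (sdc_one E A) w w.
Proof. by exists (sdc_one E A); rewrite mul1_00 mul1_01 mulr1_10. Qed.

Lemma conjugates_inv A (g : E 0 A) (w w' : E 1 A) :
  conjugates g w w' -> exists h, conjugates h w' w.
Proof.
case=> h [gh hg <-]; exists h, g; split=> //.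
by rewrite -mulA010 -mulA001 hg mul1_01 mulA100 hg mulr1_10.
Qed.

Lemma conjugates_mul A (g g' : E 0 A) (w w' w'' : E 1 A) :
  conjugates g w w' -> conjugates g' w' w'' -> conjugates (mul00 g' g) w w''.
Proof.
case=> h [gh hg <-] [h' [gh' hg' <-]]; exists (mul00 h h'); split.
- by rewrite mulA000 -(mulA000 g) gh mul1_00.
- by rewrite mulA000 -(mulA000 h') hg' mul1_00.
- by rewrite -mulA100 mulA001 mulA010.
Qed.

Lemma fmap_mul00 A B (f : hom A B) x y :
  fmap (E 0) f (mul00 x y) = mul00 (fmap (E 0) f x) (fmap (E 0) f y).
Proof. exact: (sdc_mul_nat f x y). Qed.
Lemma fmap_mul01 A B (f : hom A B) x y :
  fmap (E 1) f (mul01 x y) = mul01 (fmap (E 0) f x) (fmap (E 1) f y).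
Proof. exact: (sdc_mul_nat f x y). Qed.
Lemma fmap_mul10 A B (f : hom A B) x y :
  fmap (E 1) f (mul10 x y) = mul10 (fmap (E 1) f x) (fmap (E 0) f y).
Proof. exact: (sdc_mul_nat f x y). Qed.
Lemma fmap_mul11 A B (f : hom A B) x y :
  fmap (E 2) f (mul11 x y) = mul11 (fmap (E 1) f x) (fmap (E 1) f y).
Proof. exact: (sdc_mul_nat f x y). Qed.

Lemma conjugates_fmap A B (f : hom A B) (g : E 0 A) (w w' : E 1 A) :
  conjugates g w w' ->
  conjugates (fmap (E 0) f g) (fmap (E 1) f w) (fmap (E 1) f w').
Proof.
case=> h [gh hg <-]; exists (fmap (E 0) f h).
by rewrite -!fmap_mul00 gh hg sdc_one_nat fmap_mul10 fmap_mul01.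
Qed.

Lemma is_mc_fmap A B (f : hom A B) (w : E 1 A) : is_mc w -> is_mc (fmap (E 1) f w).
Proof. by rewrite /is_mc -fmap_mul11 => ->; rewrite sdc_d_nat. Qed.

Definition mc_map A B (f : hom A B) (w : mc A) : mc B :=
  exist _ (fmap (E 1) f (sval w)) (is_mc_fmap f (svalP w)).

Lemma mc_eq A (w w' : mc A) : sval w = sval w' -> w = w'.
Proof. by case: w w' => [w h] [w' h'] /= e; exact: eq_exist. Qed.

Definition gauge_rel A : rel (mc A) := fun w w' => `[< gauge_equiv w w' >].

Lemma gauge_rel_equiv A : equiv_class_of (@gauge_rel A).
Proof.
split=> [w|w w'|w w' w''].
- by apply/asboolP; exists (sdc_one E A); exact: conjugates_one.
- by apply/asboolP/asboolP => -[g /conjugates_inv].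
- move=> /asboolP [g hg] /asboolP [g' hg']; apply/asboolP.
  by exists (mul00 g' g); exact: conjugates_mul hg hg'.
Qed.
Canonical gauge_equiv_rel A := EquivRelPack (@gauge_rel_equiv A).

Definition def_obj A : Type := {eq_quot (@gauge_rel A)}.
Definition def_class A (w : mc A) : def_obj A := \pi_{eq_quot (@gauge_rel A)} w.

Lemma def_classP A (w w' : mc A) : def_class w = def_class w' <-> gauge_equiv w w'.
Proof.
split=> [/eqP|h]; first by rewrite eqmodE => /asboolP.
by apply/eqP; rewrite eqmodE; apply/asboolP.
Qed.

Lemma def_class_surj A (c : def_obj A) : exists w, def_class w = c.
Proof. by exists (repr (c : {eq_quot (@gauge_rel A)})); exact: reprK. Qed.

Definition def_map A B (f : hom A B) (c : def_obj A) : def_obj B :=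
  def_class (mc_map f (repr (c : {eq_quot (@gauge_rel A)}))).

Lemma def_map_class A B (f : hom A B) (w : mc A) :
  def_map f (def_class w) = def_class (mc_map f w).
Proof.
apply/def_classP.
have : gauge_equiv (repr (def_class w : {eq_quot (@gauge_rel A)})) w.
  by apply/def_classP; exact: reprK.
by case=> g hg; exists (fmap (E 0) f g); exact: conjugates_fmap.
Qed.

Lemma def_map_ext A B (f g : hom A B) : f =1 g -> def_map f =1 def_map g.
Proof.
move=> fg c; have [w <-] := def_class_surj c; rewrite !def_map_class.
by congr def_class; apply: mc_eq; exact: fmap_ext.
Qed.
Lemma def_map_id A x : def_map (hid A) x = x.
Proof.
have [w <-] := def_class_surj x; rewrite def_map_class.
by congr def_class; apply: mc_eq; exact: fmap_id.
Qed.
Lemma def_map_comp A B C (g : hom B C) (f : hom A B) x :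
  def_map (hcomp g f) x = def_map g (def_map f x).
Proof.
have [w <-] := def_class_surj x; rewrite !def_map_class.
by congr def_class; apply: mc_eq; exact: fmap_comp.
Qed.

Lemma mc_kobj : is_mc (fpt (E 1)).
Proof. by rewrite /is_mc [LHS]fpt_uniq [RHS]fpt_uniq. Qed.
Lemma def_pt_uniq (x : def_obj (kobj pi)) : x = def_class (exist _ _ mc_kobj).
Proof.
have [w <-] := def_class_surj x; congr def_class; apply: mc_eq; exact: fpt_uniq.
Qed.

(* Def_E = MC_E / E^0. *)
Definition def_functor : functor pi :=
  Functor def_map_ext def_map_id def_map_comp def_pt_uniq.

End MaurerCartan.

(* C_A -> C_R for A in C_R. *)
Section Restriction.
Variables (R : comNzRingType) (k : fieldType) (pi : {rmorphism R -> k}).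
Variable A : art pi.
Implicit Types B C : art (art_res A).

Lemma restr_res_str B r : art_res B ((art_str B \o art_str A) r) = pi r.
Proof. by rewrite /= !art_res_str. Qed.
Definition restr B : art pi :=
  @Art R k pi B (art_str B \o art_str A) (art_res B) (restr_res_str B)
    (@art_res_surj _ _ _ B) (@art_local _ _ _ B) (@art_artinian _ _ _ B).

Definition hrestr B C (f : hom B C) : hom (restr B) (restr C) :=
  @Hom R k pi (restr B) (restr C) f (fun r => hom_str f (art_str A r)) (hom_res f).

(* The structure map A -> B. *)
Definition hstr B : hom A (restr B) :=
  @Hom R k pi A (restr B) (art_str B) (fun=> erefl) (@art_res_str _ _ _ B).

Lemma hstr_comp B C (f : hom B C) : hcomp (hrestr f) (hstr B) =1 hstr C.
Proof. by move=> a; exact: (hom_str f). Qed.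

Lemma kobj_restr_str r :
  idfun (art_str (kobj pi) r) = art_str (restr (kobj (art_res A))) r.
Proof. by rewrite /= art_res_str. Qed.
Definition kobj_restr : hom (kobj pi) (restr (kobj (art_res A))) :=
  @Hom R k pi (kobj pi) (restr (kobj (art_res A))) idfun
    kobj_restr_str (fun=> erefl).
Lemma restr_kobj_str r :
  idfun (art_str (restr (kobj (art_res A))) r) = art_str (kobj pi) r.
Proof. by rewrite /= art_res_str. Qed.
Definition restr_kobj : hom (restr (kobj (art_res A))) (kobj pi) :=
  @Hom R k pi (restr (kobj (art_res A))) (kobj pi) idfun
    restr_kobj_str (fun=> erefl).

Lemma restr_kobj_uniq (F : functor pi) (x y : F (restr (kobj (art_res A)))) : x = y.
Proof.
have h z : z = fmap F kobj_restr (fmap F restr_kobj z).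
  by rewrite -fmap_comp -[LHS](fmap_id F); apply: fmap_ext.
rewrite (h x) (h y); congr (fmap F _ _).
by rewrite [LHS]fpt_uniq [RHS]fpt_uniq.
Qed.
End Restriction.

Section Iso.
Variables (R : comNzRingType) (k : fieldType) (pi : {rmorphism R -> k}).
Variables (E : sdc pi) (A : art pi) (w w' : mc E A).
Implicit Types B C : art (art_res A).

Definition is_iso B (g : E 0 (restr B)) : Prop :=
  conjugates g (fmap (E 1) (hstr B) (sval w)) (fmap (E 1) (hstr B) (sval w')).

Definition iso_obj B : Type := {g : E 0 (restr B) | is_iso g}.

Lemma iso_eq B (x y : iso_obj B) : sval x = sval y -> x = y.
Proof. by case: x y => [x h] [y h'] /= e; exact: eq_exist. Qed.

Lemma iso_map_subproof B C (f : hom B C) (x : iso_obj B) :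
  @is_iso C (fmap (E 0) (hrestr f) (sval x)).
Proof.
rewrite /is_iso -!(fmap_ext _ (hcomp (hrestr f) (hstr B)) (hstr C) (hstr_comp f)).
by rewrite !fmap_comp; apply: conjugates_fmap; exact: (svalP x).
Qed.
Definition iso_map B C (f : hom B C) (x : iso_obj B) : iso_obj C :=
  exist (@is_iso C) _ (iso_map_subproof f x).

Lemma iso_map_ext B C (f g : hom B C) : f =1 g -> iso_map f =1 iso_map g.
Proof. by move=> fg x; apply: iso_eq; exact: fmap_ext. Qed.
Lemma iso_map_id B x : iso_map (hid B) x = x.
Proof.
apply: iso_eq; rewrite /= -[RHS](fmap_id (E 0)); exact: fmap_ext.
Qed.
Lemma iso_map_comp B C D (g : hom C D) (f : hom B C) x :
  iso_map (hcomp g f) x = iso_map g (iso_map f x).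
Proof.
apply: iso_eq; rewrite /= -[RHS](fmap_comp (E 0)); exact: fmap_ext.
Qed.

Lemma iso_pt_subproof : is_iso (sdc_one E (restr (kobj (art_res A)))).
Proof.
set K := kobj (art_res A).
rewrite /is_iso (@restr_kobj_uniq _ _ _ A (E 1)
  (fmap (E 1) (hstr K) (sval w')) (fmap (E 1) (hstr K) (sval w))).
exact: conjugates_one.
Qed.
Lemma iso_pt_uniq (x : iso_obj (kobj (art_res A))) :
  x = exist _ _ iso_pt_subproof.
Proof. by apply: iso_eq; exact: restr_kobj_uniq. Qed.

Definition iso_functor : functor (art_res A) :=
  Functor iso_map_ext iso_map_id iso_map_comp iso_pt_uniq.
End Iso.

(* Main.v *)
From Pilot Require Import Defs.
From HB Require Import structures.
From mathcomp Require Import all_boot all_order all_algebra.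
From mathcomp Require Import boolp.
(* [hom] denotes morphisms of Artinian algebras again, not linear maps. *)
Import Pilot.Defs.

Set Implicit Arguments.
Unset Strict Implicit.
Unset Printing Implicit Defensive.

Import GRing.Theory.
Local Open Scope ring_scope.
Local Open Scope quotient_scope.

(** On small extensions a simplicial deformation complex behaves like the units
    and the Maurer-Cartan elements of a differential graded algebra, and every
    assertion is a computation with cochains.

    Let [A -> B] be a small extension with kernel [V].  Since [A x_B A] is
    [A x_k (k + V)], a homogeneous functor [F] makes each non-empty fibre of
    [F A -> F B] a torsor under [F (k + V)], the vector space [t_F (x) V]; write
    [x + v] for this action ([shift]).  Natural operations commute with it.  On
    [F (k + V)] addition is induced by maps between square-zero extensions, so
    that natural operations are linear there, and one of two arguments is the
    sum of its two partial operations ([natural_biadditive]).  For the product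
    of the complex this reads
    [(x + v) * (y + w) = x * y + (v * omega0 + omega0 * w)]: it is governed by
    the outer cofaces.

    Deformations.  If [x] in [E^1 A] lifts a Maurer-Cartan element of [B], then
    [x * x = d^1 x + o] for a unique [o] in [E^2 (k + V)].  Passing from [x] to
    [x + v] adds the coboundary of [v] to [o] ([mc_defect_shift]), associativity
    of [x * x * x] makes [o] a cocycle ([mc_defect_cocycle]), and conjugation
    leaves it unchanged ([mc_defect_gauge]).  The class of [o] in [H^2 (x) V] is
    therefore an invariant of the deformation, and vanishes exactly when [x]
    can be corrected to a Maurer-Cartan element.  Over [k + V] itself the
    Maurer-Cartan equation says that [w] is a cocycle and gauge equivalence that
    [w - w'] is a coboundary, whence the tangent space [H^1].

    Isomorphisms.  Induction along small extensions shows that [E^0] is a group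
    ([E0_inverse]), so [g * w * g^-1 = w'] becomes the equation
    [g * w = w' * g] in [E^1], which can be tested on the factors of a fibre
    product.  For a lift of a solution along [A -> B] the defect [o] in
    [g * w = w' * g + o] is a cocycle, because [g * w * g^-1 = w' + o] is a
    Maurer-Cartan element along with [w'], and [g + v] has defect [o - dv].
    Over [k + V] the equation says that [g] is a cocycle.

    Gluing.  A gauge transformation over [A] lifts along a surjection [B -> A],
    which makes the comparison map of fibre products surjective for deformation
    classes.  It is injective as soon as gauge transformations over [B] and [C]
    between the same two elements have the same image over [A].  This is clear
    if [A] is [k], and if [H^0] vanishes an intertwiner is unique, again by
    induction along small extensions ([intertwiner_uniq]).

    The induction ([art_ind]) rests on the nilpotency of the maximal ideal.  The
    kernel [J] of a small extension is finite dimensional ([exists_frame]), so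
    that an element of [H (x) J] is determined by its contractions with linear
    forms on [J] ([tensor_ext]); this is how cocycles with coefficients in [J]
    give a functorial class ([obstruction_space_of_cocycles]). *)

(** * Nilpotency in Artinian rings *)

Section ArtinianRings.
Variable R : comNzRingType.
Implicit Types (I J K : R -> Prop) (x y z : R).

Lemma is_idealN I x : is_ideal I -> I x -> I (- x).
Proof. by case=> _ _ IM Ix; rewrite -mulN1r; apply: IM. Qed.

Lemma is_idealB I x y : is_ideal I -> I x -> I y -> I (x - y).
Proof. by move=> idI Ix Iy; have [_ ID _] := idI; apply: ID => //; apply: is_idealN. Qed.

Lemma is_ideal_sum I (T : Type) (s : seq T) (P : pred T) (F : T -> R) :
  is_ideal I -> (forall i, P i -> I (F i)) -> I (\sum_(i <- s | P i) F i).
Proof. by case=> I0 ID _; apply: big_ind. Qed.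

(** The chain condition speaks of sequences; if no member of [Q] were minimal,
    dependent choice would produce a strictly decreasing one. *)
Lemma artinian_minimal (Q : (R -> Prop) -> Prop) (K0 : R -> Prop) :
  is_artinian R -> is_ideal K0 -> Q K0 ->
  exists K, [/\ is_ideal K, Q K & forall K', is_ideal K' -> Q K' ->
    (forall x, K' x -> K x) -> forall x, K x -> K' x].
Proof.
move=> artR idK0 QK0; apply: contrapT => nomin.
pose T := {K : R -> Prop | is_ideal K /\ Q K}.
have next (K : T) : {K' : T | (forall x, sval K' x -> sval K x) /\
    exists x, sval K x /\ ~ sval K' x}.
  apply: cid; apply: contrapT => nonext; apply: nomin; exists (sval K).
  have [idK QK] := svalP K; split=> // K' idK' QK' sub x Kx.
  apply: contrapT => nK'x; apply: nonext.
  by exists (exist _ K' (conj idK' QK')); split=> //; exists x.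
pose I n := sval (iter n (fun K : T => sval (next K)) (exist _ K0 (conj idK0 QK0) : T)).
have [n|n x|N stab] := artR I.
- by rewrite /I; have [] :=
    svalP (iter n (fun K : T => sval (next K)) (exist _ K0 (conj idK0 QK0))).
- by rewrite /I /=; case: (next _) => K' /= [sub _]; apply: sub.
have [_ [x [INx nIx]]] : (forall x, I N.+1 x -> I N x) /\ exists x, I N x /\ ~ I N.+1 x.
  by rewrite /I /=; case: (next _).
by apply: nIx; apply: stab.
Qed.

(** The powers of an ideal [m].  The product of two ideals is taken as the
    intersection of the ideals containing all products of elements, so that
    inclusions are proved without manipulating finite sums. *)
Fixpoint ideal_pow (m : R -> Prop) (n : nat) : R -> Prop :=
  if n is n'.+1 then
    fun x => forall K, is_ideal K ->
      (forall a b, m a -> ideal_pow m n' b -> K (a * b)) -> K x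
  else fun=> True.

Section Powers.
Variable m : R -> Prop.
Hypothesis idm : is_ideal m.

Lemma ideal_pow_ideal n : is_ideal (ideal_pow m n).
Proof.
case: n => [|n]; first by split.
split=> [K [] //|x y hx hy K idK hK|a x hx K idK hK]; have [_ KD KM] := idK.
- by apply: KD; [exact: hx|exact: hy].
- by apply: KM; exact: hx.
Qed.

Lemma ideal_pow_mul n a b : m a -> ideal_pow m n b -> ideal_pow m n.+1 (a * b).
Proof. by move=> ma hb K _; apply. Qed.

Lemma ideal_powS n x : ideal_pow m n.+1 x -> ideal_pow m n x.
Proof.
by move=> /(_ _ (ideal_pow_ideal n)); apply=> a b _; case: (ideal_pow_ideal n) => _ _; apply.
Qed.

Lemma ideal_pow1 x : ideal_pow m 1 x <-> m x.
Proof.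
split=> [/(_ _ idm)|mx]; last by rewrite -[x]mulr1; apply: ideal_pow_mul.
by apply=> a b ma _; rewrite mulrC; case: idm => _ _; apply.
Qed.

Lemma ideal_pow_le n n' x : (n <= n')%N -> ideal_pow m n' x -> ideal_pow m n x.
Proof.
move=> /subnK <-; elim: (n' - n)%N => // j IH; rewrite addSn => /ideal_powS; exact: IH.
Qed.

(** By induction on [n], a factor [a] from [m] being absorbed by passing from [L]
    to the ideal of those [z] with [a * z] in [L]. *)
Lemma ideal_pow_add n n' (L : R -> Prop) : is_ideal L ->
  (forall x y, ideal_pow m n x -> ideal_pow m n' y -> L (x * y)) ->
  forall x, ideal_pow m (n + n') x -> L x.
Proof.
elim: n L => [|n IH] L idL hL x.
  by move=> hx; rewrite -[x]mul1r; apply: hL.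
have [L0 LD LM] := idL.
apply=> // a b ma; apply: (IH (fun z => L (a * z))) => [|y z hy hz].
  split=> [|y z|c y]; rewrite ?mulr0 // ?mulrDr; first exact: LD.
  by move=> h; rewrite mulrCA; apply: LM.
by rewrite mulrA; apply: hL => //; apply: ideal_pow_mul.
Qed.

(** If the powers of [m] became stationary at a non-zero ideal [I], a minimal
    ideal among those not killing [I] would be of the form [(x)] with
    [x = x * y] for some [y] in [I], although [1 - y] is a unit. *)
Lemma ideal_pow_nilpotent : is_artinian R ->
  (forall x, m x -> is_unit (1 - x)) -> exists n, forall x, ideal_pow m n x -> x = 0.
Proof.
move=> artR unit1; have [N stab] := artR _ ideal_pow_ideal (fun n x => @ideal_powS n x).
exists N; apply: contrapT => hN.
set I := ideal_pow m N in stab hN.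
have idI : is_ideal I := ideal_pow_ideal N.
have [I0 ID IM] := idI.
have Im x : I x -> m x.
  by move=> Ix; apply/ideal_pow1; apply: (@ideal_pow_le 1 N.+1) => //; apply: stab.
(* As [I] is contained in its own square, what kills the square kills [I]. *)
have kill x : (forall y z, I y -> I z -> x * (y * z) = 0) -> forall y, I y -> x * y = 0.
  move=> h y Iy; apply: (@ideal_pow_add N N (fun y => x * y = 0)) => //.
    split=> [|u v hu hv|c u hu]; rewrite ?mulr0 // ?mulrDr ?hu ?hv ?addr0 //.
    by rewrite mulrCA hu mulr0.
  by apply: stab Iy; rewrite leq_addr.
pose Q K := exists x y, [/\ K x, I y & x * y != 0].
have QI : Q I.
  apply: contrapT => nQ; apply: hN => x Ix; rewrite -[x]mul1r.
  apply: kill => // y z Iy Iz; rewrite mul1r; apply: contrapT => /eqP yz.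
  by apply: nQ; exists y, z.
have [K [idK [x [y [Kx Iy xy]]] minK]] := artinian_minimal artR idI QI.
pose xI z := exists2 t, I t & z = x * t.
have xIK z : xI z -> K z.
  by case=> t _ ->; rewrite mulrC; case: idK => _ _; apply.
have id_xI : is_ideal xI.
  split; first by exists 0; rewrite ?mulr0.
    by move=> _ _ [s Is ->] [t It ->]; exists (s + t); rewrite ?mulrDr //; apply: ID.
  by move=> a _ [t It ->]; exists (a * t); [exact: IM|rewrite mulrCA].
have [|t It xt] := minK xI id_xI _ xIK x Kx.
  apply: contrapT => nQ; case/eqP: xy; apply: kill Iy => s z Is Iz.
  apply: contrapT => /eqP; rewrite mulrA => xsz; apply: nQ.
  by exists (x * s), z; split=> //; exists s.
have [u ut] := unit1 t (Im _ It).
case/eqP: xy; have -> : x = 0; last by rewrite mul0r.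
by rewrite -[x]mulr1 -ut mulrCA mulrBr mulr1 -xt subrr mulr0.
Qed.

End Powers.

End ArtinianRings.

(** * Quotients in the category of Artinian algebras *)

Section ArtObjects.
Variables (R : comNzRingType) (k : fieldType) (pi : {rmorphism R -> k}).
Implicit Types A B : art pi.

(** [x * y] and [1 - x * y] cannot both be non-units; here [y] is chosen so
    that the second one has residue zero. *)
Lemma art_unit A (x : A) : art_res A x != 0 -> is_unit x.
Proof.
move=> x0; have [y hy] := art_res_surj A (art_res A x)^-1.
apply: contrapT => nx; apply: (@art_local _ _ _ A (x * y) (1 - x * y)).
- by case=> z hz; apply: nx; exists (z * y); rewrite -mulrA (mulrC y).
- case=> z /(congr1 (art_res A)) /eqP.
  by rewrite rmorphM rmorphB rmorphM /= hy rmorph1 divff // subrr mulr0 eq_sym oner_eq0.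
- by exists 1; rewrite mul1r addrC subrK.
Qed.

Definition art_max A (x : A) : Prop := art_res A x = 0.

Lemma art_max_ideal A : is_ideal (@art_max A).
Proof.
split=> [|x y|a x]; rewrite /art_max ?rmorph0 // ?rmorphD ?rmorphM.
  by move=> -> ->; rewrite addr0.
by move=> ->; rewrite mulr0.
Qed.

Lemma art_max_nilpotent A : exists n, forall x, ideal_pow (@art_max A) n x -> x = 0.
Proof.
apply: ideal_pow_nilpotent (@art_artinian _ _ _ A) _ => [|x mx].
  exact: art_max_ideal.
by apply: art_unit; rewrite rmorphB rmorph1 mx subr0 oner_neq0.
Qed.

Section Quotient.
Variables (A : art pi) (I : A -> Prop).
Hypotheses (idI : is_ideal I) (Im : forall x, I x -> art_max x).

Definition ideal_pred : {pred A} := fun x => `[< I x >].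

Lemma ideal_pred_closed : idealr_closed ideal_pred.
Proof.
have [I0 ID IM] := idI; split; first exact/asboolP.
  by apply/negP => /asboolP /Im /eqP; rewrite rmorph1 oner_eq0.
by move=> a x y /asboolP Ix /asboolP Iy; apply/asboolP/ID => //; apply: IM.
Qed.
HB.instance Definition _ := isIdealr.Build A ideal_pred ideal_pred_closed.

Definition art_quot : comNzRingType := {ideal_quot ideal_pred}.
Definition art_proj : {rmorphism A -> art_quot} := \pi_({ideal_quot ideal_pred}).

Lemma art_projP x y : art_proj x = art_proj y <-> I (x - y).
Proof.
split=> [/eqP|h]; first by rewrite -Quotient.idealrBE => /asboolP.
by apply/eqP; rewrite -Quotient.idealrBE; apply/asboolP.
Qed.

Lemma art_proj_surj c : exists x, art_proj x = c.
Proof. by exists (repr c); exact: reprK. Qed.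

Definition quot_res (c : art_quot) : k := art_res A (repr c).

Lemma quot_res_proj x : quot_res (art_proj x) = art_res A x.
Proof.
have : I (repr (art_proj x) - x) by apply/art_projP; exact: reprK.
by move=> /Im /eqP; rewrite rmorphB subr_eq0 => /eqP.
Qed.

Lemma quot_res_add : zmod_morphism quot_res.
Proof.
move=> c d; have [x <-] := art_proj_surj c; have [y <-] := art_proj_surj d.
by rewrite -rmorphB !quot_res_proj rmorphB.
Qed.
Lemma quot_res_mul : monoid_morphism quot_res.
Proof.
split=> [|c d]; first by rewrite -(rmorph1 art_proj) quot_res_proj rmorph1.
have [x <-] := art_proj_surj c; have [y <-] := art_proj_surj d.
by rewrite -rmorphM !quot_res_proj rmorphM.
Qed.
HB.instance Definition _ := GRing.isZmodMorphism.Build art_quot k quot_res quot_res_add.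
HB.instance Definition _ := GRing.isMonoidMorphism.Build art_quot k quot_res quot_res_mul.

Lemma quot_res_str r : quot_res ((art_proj \o art_str A) r) = pi r.
Proof. by rewrite /= quot_res_proj art_res_str. Qed.
Lemma quot_res_surj c : exists x, quot_res x = c.
Proof. by have [x <-] := art_res_surj A c; exists (art_proj x); exact: quot_res_proj. Qed.
Lemma quot_local : is_local art_quot.
Proof.
apply: (@local_of_res k art_quot quot_res) => c.
have [x <-] := art_proj_surj c; rewrite /= quot_res_proj => /art_unit [y yx].
by exists (art_proj y); rewrite -rmorphM yx rmorph1.
Qed.
Lemma quot_artinian : is_artinian art_quot.
Proof.
move=> J idJ decJ.
have [n|n x|N hN] := @art_artinian _ _ _ A (fun n x => J n (art_proj x)).
- have [J0 JD JM] := idJ n; split=> [|x y|a x]; rewrite ?rmorph0 // ?rmorphD ?rmorphM //.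
    exact: JD.
  exact: JM.
- exact: decJ.
by exists N => n c le; have [x <-] := art_proj_surj c; apply: hN.
Qed.
Definition quot_art : art pi :=
  @Art R k pi art_quot (art_proj \o art_str A) quot_res
    quot_res_str quot_res_surj quot_local quot_artinian.
Definition hproj : hom A quot_art :=
  @Hom R k pi A quot_art art_proj (fun=> erefl) quot_res_proj.

Lemma hproj_eq0 x : hproj x = 0 <-> I x.
Proof. by rewrite -[x in I x]subr0 -art_projP rmorph0. Qed.
Lemma hproj_surj : hsurj hproj. Proof. exact: art_proj_surj. Qed.

(** The powers of the maximal ideal of the quotient are images of those of [A];
    in particular dividing by a power makes that power vanish. *)
Lemma quot_max_pow n (x : A) :
  ideal_pow (@art_max quot_art) n (hproj x) -> exists y, ideal_pow (@art_max A) n y /\ I (x - y).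
Proof.
have idm := @art_max_ideal A; have [I0 ID IM] := idI.
elim: n x => [|n IH] x; first by exists x; rewrite subrr.
pose K (c : art_quot) := exists y, ideal_pow (@art_max A) n.+1 y /\ c = art_proj y.
move=> h; suff [y [hy /art_projP hxy]] : K (hproj x) by exists y.
have [P0 PD PM] := ideal_pow_ideal (@art_max A) n.+1.
apply: h; first split.
- by exists 0; rewrite rmorph0.
- by move=> _ _ [y [hy ->]] [z [hz ->]]; exists (y + z); rewrite rmorphD; split=> //; apply: PD.
- move=> c _ [y [hy ->]]; have [a <-] := art_proj_surj c.
  by exists (a * y); rewrite rmorphM; split=> //; apply: PM.
move=> c d; have [a <-] := art_proj_surj c; have [b <-] := art_proj_surj d.
rewrite /art_max /= quot_res_proj => ma /IH [y [hy hby]].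
exists (a * y); split; first exact: ideal_pow_mul.
by rewrite rmorphM; congr (_ * _); apply/art_projP.
Qed.
End Quotient.

End ArtObjects.

(** * Small extensions and induction along them *)

Section Frames.
Variables (R : comNzRingType) (k : fieldType) (pi : {rmorphism R -> k}).
Variables (A : art pi) (J : A -> Prop).
Hypotheses (idJ : is_ideal J) (mJ : forall a x, art_max a -> J x -> a * x = 0).

Definition in_span (x : nat -> A) n (y : A) : Prop :=
  exists c : nat -> A, y = \sum_(i < n) c i * x i.

(** Since the maximal ideal kills [J], coefficients matter only through their
    residues; a coefficient with non-zero residue is a unit and could be
    divided by. *)
Lemma in_span_independent (x : nat -> A) n (c : nat -> A) :
  (forall i, J (x i)) -> (forall i, (i < n)%N -> ~ in_span x i (x i)) ->
  \sum_(i < n) c i * x i = 0 -> forall i, (i < n)%N -> art_max (c i).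
Proof.
move=> Jx; elim: n => [//|n IH] nspan; rewrite big_ord_recr /= => sum0.
have mcn : art_max (c n).
  apply: contrapT => /eqP /art_unit [u uc]; apply: (nspan n) => //.
  exists (fun i => - u * c i); apply/eqP; rewrite -subr_eq0.
  have -> : x n - \sum_(i < n) - u * c i * x i =
      u * (\sum_(i < n) c i * x i + c n * x n).
    rewrite mulrDr mulrA uc mul1r addrC mulr_sumr -sumrN; congr (_ + _).
    by apply: eq_bigr => i _; rewrite !mulNr opprK mulrA.
  by rewrite sum0 mulr0.
move=> i; rewrite ltnS leq_eqVlt => /orP [/eqP -> //|lt_in].
apply: IH lt_in => [l lt_ln|]; first by apply: nspan; apply: ltnW.
by move: sum0; rewrite (mJ mcn (Jx n)) addr0.
Qed.

(** An ideal killed by the maximal ideal is a [k]-vector space all of whose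
    subspaces are ideals.  Were it infinite dimensional, the tails of an
    independent sequence would span a strictly decreasing sequence of ideals. *)
Lemma finite_span : exists n (x : nat -> A),
  [/\ forall i, J (x i), forall i, (i < n)%N -> ~ in_span x i (x i) &
      forall y, J y -> in_span x n y].
Proof.
have [J0 JD JM] := idJ.
(* [pick s] lies outside the span of [s] whenever some element of [J] does. *)
pose outside (s : seq A) y := J y /\ ~ in_span (nth 0 s) (size s) y.
have pickP (s : seq A) : {y | J y /\ ((exists y, outside s y) -> outside s y)}.
  apply: cid; have [[y hy]|no] := pselect (exists y, outside s y).
    by exists y; have [Jy _] := hy.
  by exists 0.
pose pick s := sval (pickP s).
pose s n := iter n (fun t => rcons t (pick t)) [::].
pose x n := pick (s n).
have sE n : s n = mkseq x n.
  by elim: n => // n IH; rewrite mkseqS -IH.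
have spanE n y : in_span (nth 0 (s n)) (size (s n)) y <-> in_span x n y.
  rewrite sE size_mkseq; split=> -[c ->]; exists c;
    by apply: eq_bigr => i _; rewrite nth_mkseq.
have Jx i : J (x i) by rewrite /x /pick; case: (pickP _) => y [].
have out n : (exists y, J y /\ ~ in_span x n y) -> ~ in_span x n (x n).
  case=> y [Jy hy]; rewrite /x /pick; case: (pickP _) => z /= [_ hz].
  have [|_] := hz; first by exists y; split=> //; rewrite spanE.
  by rewrite spanE.
have [[n hn]|inf] := pselect (exists n, forall y, J y -> in_span x n y).
  have exP : exists n, `[< forall y, J y -> in_span x n y >] by exists n; apply/asboolP.
  case: (ex_minnP exP) => N /asboolP hN minN; exists N, x; split=> // i lt_iN.
  apply: out; apply: contrapT => no; suff : (N <= i)%N by rewrite leqNgt lt_iN.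
  by apply: minN; apply/asboolP => y Jy; apply: contrapT => hy; apply: no; exists y.
have nspan n : ~ in_span x n (x n).
  apply: out; apply: contrapT => no; apply: inf; exists n => y Jy.
  by apply: contrapT => hy; apply: no; exists y.
(* [W n] is the ideal spanned by the [x i] with [n <= i]. *)
pose W n y := exists (N : nat) (c : nat -> A),
  (forall i, (i < n)%N -> c i = 0) /\ y = \sum_(i < N) c i * x i.
exfalso.
have pad (N N' : nat) (c : nat -> A) : (N <= N')%N ->
    \sum_(i < N) c i * x i = \sum_(i < N') (if (i < N)%N then c i else 0) * x i.
  move=> le_NN'; rewrite (big_ord_widen N' (fun i => c i * x i) le_NN') big_mkcond.
  by apply: eq_bigr => i _; case: ifP => // _; rewrite mul0r.
have [n|n y|N stab] := @art_artinian _ _ _ A W.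
- split=> [|y z|a y].
  + by exists 0%N, (fun=> 0); rewrite big_ord0.
  + case=> [N [c [hc ->]]] [N' [c' [hc' ->]]].
    rewrite (pad N _ c (leq_maxl N N')) (pad N' _ c' (leq_maxr N N')).
    exists (maxn N N'), (fun i => (if (i < N)%N then c i else 0) +
      (if (i < N')%N then c' i else 0)); split=> [i lt_in|].
      by rewrite hc // hc' // !if_same addr0.
    by rewrite -big_split; apply: eq_bigr => i _; rewrite mulrDl.
  + case=> [N [c [hc ->]]]; exists N, (fun i => a * c i); split=> [i lt_in|].
      by rewrite hc ?mulr0.
    by rewrite mulr_sumr; apply: eq_bigr => i _; rewrite mulrA.
- by case=> N [c [hc ->]]; exists N, c; split=> // i lt_in; apply/hc/ltnW.
have [|M [c [hc e]]] := stab N.+1 (x N) (leqnSn N).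
  exists N.+1, (fun i => (i == N)%:R); split=> [i lt_iN|].
    by rewrite ltn_eqF.
  rewrite big_ord_recr /= eqxx mul1r big1 ?add0r // => i _.
  by rewrite ltn_eqF ?mul0r.
(* Expressing [x N] through later terms is a relation with coefficient [-1] at
   [N], against the independence of the sequence. *)
pose M' := maxn M N.+1.
pose d i := (if (i < M)%N then c i else 0) - (i == N)%:R.
have : art_max (d N).
  apply: (@in_span_independent x M') => //; last by rewrite leq_maxr.
  rewrite /d; under eq_bigr => i _ do rewrite mulrBl.
  rewrite sumrB -(pad M _ c (leq_maxl _ _)) -e.
  have lt : (N < M')%N by rewrite leq_maxr.
  rewrite (bigD1 (Ordinal lt)) //= eqxx mul1r big1 ?addr0 ?subrr // => i ne.
  by rewrite (_ : (i == N :> nat) = false) ?mul0r //; apply/negbTE; move: ne; rewrite -val_eqE.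
rewrite /d eqxx hc // if_same sub0r /art_max rmorphN rmorph1 => /eqP.
by rewrite oppr_eq0 oner_eq0.
Qed.

(** The residue field acts on [J] by multiplication with arbitrary lifts, and
    the sequence of [finite_span] is a basis for this action. *)
Lemma exists_frame : exists n (j : {additive 'rV[k]_n -> A}),
  [/\ injective j, forall x, J x <-> exists v, x = j v &
      forall x v, x * j v = j (art_res A x *: v)].
Proof.
have [J0 JD JM] := idJ.
have [n [x [Jx nspan spanJ]]] := finite_span.
pose lift (a : k) : A := sval (cid (art_res_surj A a)).
have liftK a : art_res A (lift a) = a by rewrite /lift; case: cid.
have same a b y : art_res A a = art_res A b -> J y -> a * y = b * y.
  move=> ab Jy; apply/eqP; rewrite -subr_eq0 -mulrBl mJ //.
  by rewrite /art_max rmorphB ab subrr.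
pose jf (v : 'rV[k]_n) : A := \sum_(i < n) lift (v 0 i) * x i.
have jadd : zmod_morphism jf.
  move=> u v; rewrite /jf -sumrB; apply: eq_bigr => i _; rewrite -mulrBl.
  by apply: same => //; rewrite rmorphB !liftK !mxE.
pose jM := GRing.isZmodMorphism.Build 'rV[k]_n A jf jadd.
pose j : {additive 'rV[k]_n -> A} := HB.pack jf jM.
exists n, j; split=> [u v|y|y v].
- move=> uv; apply/eqP; rewrite -subr_eq0; apply/eqP.
  have h0 : j (u - v) = 0 by rewrite raddfB uv subrr.
  apply/rowP => i; rewrite [RHS]mxE -(liftK ((u - v) 0 i)).
  pose c (l : nat) := if insub l is Some l' then lift ((u - v) 0 l') else 0 : A.
  have -> : lift ((u - v) 0 i) = c i by rewrite /c valK.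
  apply: (@in_span_independent x n c) => //.
  by rewrite -[RHS]h0; apply: eq_bigr => l _; rewrite /c valK.
- split=> [/spanJ [c ->]|[v ->]]; last first.
    by apply: is_ideal_sum => // i _; apply: JM.
  exists (\row_i art_res A (c i)); apply: eq_bigr => i _.
  by apply: same => //; rewrite liftK mxE.
- rewrite /= /jf mulr_sumr; apply: eq_bigr => i _; rewrite mulrA; apply: same => //.
  by rewrite rmorphM !liftK !mxE.
Qed.
End Frames.

Section ArtInduction.
Variables (R : comNzRingType) (k : fieldType) (pi : {rmorphism R -> k}).

(** Small extensions with a parametrisation of the kernel, so that the kernel may
    serve as coefficients: the square-zero extension [k + V] needs a finite
    dimensional [V], while a bare small extension only has an ideal. *)
Record is_framed (A B : art pi) (f : hom A B) (V : vectType k)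
    (j : {additive V -> A}) : Prop := IsFramed {
  fr_surj : hsurj f;
  fr_inj : injective j;
  fr_ker : forall x, f x = 0 <-> exists v, x = j v;
  fr_scale : forall x v, x * j v = j (art_res A x *: v) }.

Lemma framed_ker0 A B (f : hom A B) (V : vectType k) (j : {additive V -> A}) v :
  is_framed f j -> f (j v) = 0.
Proof. by move=> h; apply/(fr_ker h); exists v. Qed.

Lemma exists_framed (A B : art pi) (f : hom A B) : hsurj f ->
  (forall a x, art_max a -> f x = 0 -> a * x = 0) ->
  exists n (j : {additive 'rV[k]_n -> A}), is_framed f j.
Proof.
move=> fS mf; have idf : is_ideal (fun x => f x = 0).
  split=> [|x y|a x]; rewrite ?rmorph0 // ?rmorphD ?rmorphM.
    by move=> -> ->; rewrite addr0.
  by move=> ->; rewrite mulr0.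
by have [n [j [? ? ?]]] := exists_frame idf mf; exists n, j; split.
Qed.

Definition hres (A : art pi) : hom A (kobj pi) :=
  @Hom R k pi A (kobj pi) (art_res A) (@art_res_str _ _ _ A) (fun=> erefl).

Lemma hres_surj A : hsurj (hres A). Proof. exact: art_res_surj. Qed.

(** Every object of the category is reached from [k] by small extensions,
    successively dividing out the powers of the maximal ideal. *)
Lemma art_ind (P : art pi -> Prop) : P (kobj pi) ->
  (forall A B (f : hom A B) n (j : {additive 'rV[k]_n -> A}),
    is_framed f j -> P B -> P A) -> forall A, P A.
Proof.
move=> Pk Psmall A.
have [N hN] := art_max_nilpotent A.
have {}hN x : ideal_pow (@art_max _ _ _ A) N.+1 x -> x = 0 by move=> /ideal_powS /hN.
elim: N A hN => [|N IH] A hN; have idm := @art_max_ideal _ _ _ A.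
  have [n [j hj]] := @exists_framed _ _ (hres A) (@hres_surj A)
    (fun a x ma mx => hN _ (@ideal_pow_mul _ _ 0 a x ma Logic.I)).
  exact: Psmall hj Pk.
pose I := ideal_pow (@art_max _ _ _ A) N.+1.
have idI : is_ideal I by exact: ideal_pow_ideal.
have Im x : I x -> art_max x by move=> /(ideal_pow_le (isT : 1 <= N.+1)%N) /(ideal_pow1 idm).
have [|n [j hj]] := @exists_framed _ _ _ (@hproj_surj _ _ _ A I idI Im).
  by move=> a x ma /hproj_eq0 Ix; apply: hN; apply: ideal_pow_mul.
apply: Psmall hj _; apply: IH => c; have [x <-] := @art_proj_surj _ _ _ A I idI Im c.
move=> /quot_max_pow [y [Iy Ixy]]; apply/hproj_eq0; rewrite -[x](subrK y).
by have [_ ID _] := idI; apply: ID.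
Qed.
End ArtInduction.

(** * The vector spaces F (k + J) *)

Section VectorTangent.
Variables (R : comNzRingType) (k : fieldType) (pi : {rmorphism R -> k}).
Variables (F : functor pi) (hF : pointwise_homogeneous F).
Implicit Types J : vectType k.

(** A model of [t_F (x) J] that needs no basis of [J]; for [J = k] its operations
    are those of the tangent space.  The proof of homogeneity is an argument
    because the vector space structure is computed from it. *)
Definition tsp (_ : pointwise_homogeneous F) J : Type := F (sqzobj pi J).
Local Notation T := (tsp hF).

Definition tsp_zero J : T J := fmap F (hsqz_in pi J) (fpt F).
Definition tsp_add J (x y : T J) : T J :=
  lact (fst \+ snd : {linear (J * J)%type -> J}) (tpair hF x y).
Definition tsp_scale J (a : k) (x : T J) : T J := lact ( *:%R a : {linear J -> J}) x.
Definition tsp_opp J (x : T J) : T J := tsp_scale (- 1) x.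

Lemma tsp_addE J J' (u v : {linear J -> J'}) t :
  tsp_add (lact u t) (lact v t) = lact (u \+ v : {linear J -> J'}) t.
Proof.
pose w (x : J) : (J' * J')%type := (u x, v x).
have wL : linear w by move=> a x y; rewrite /w !linearP.
pose wM := GRing.isLinear.Build k J (J' * J')%type *:%R w wL.
pose W : {linear J -> (J' * J')%type} := HB.pack w wM.
rewrite /tsp_add; have -> : tpair hF (lact u t) (lact v t) = lact W t.
  by apply: (tpair_uniq hF); rewrite ?tpair1 ?tpair2 lact_comp; apply: lact_ext.
by rewrite lact_comp; apply: lact_ext.
Qed.

Lemma tsp_zeroE J J' t : lact (\0 : {linear J -> J'}) t = tsp_zero J'.
Proof.
rewrite /tsp_zero -(fpt_uniq F (fmap F (hsqz_out pi J) t)) -fmap_comp.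
by apply: fmap_ext.
Qed.

Lemma tsp_scaleE J J' a (u : {linear J -> J'}) t :
  tsp_scale a (lact u t) = lact (a \*: u : {linear J -> J'}) t.
Proof. by rewrite /tsp_scale lact_comp; apply: lact_ext. Qed.

Lemma tsp_addA J : associative (@tsp_add J).
Proof.
move=> x y z; pose t := tpair hF x (tpair hF y z).
pose p1 : {linear (J * (J * J))%type -> J} := fst.
pose p2 : {linear (J * (J * J))%type -> J} := fst \o snd.
pose p3 : {linear (J * (J * J))%type -> J} := snd \o snd.
have <- : lact p1 t = x by rewrite tpair1.
have <- : lact p2 t = y by rewrite -lact_comp tpair2 tpair1.
have <- : lact p3 t = z by rewrite -lact_comp tpair2 tpair2.
by rewrite !tsp_addE; apply: lact_ext => c /=; rewrite addrA.
Qed.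

Lemma tsp_addC J : commutative (@tsp_add J).
Proof.
move=> x y; pose t := tpair hF x y.
have <- : lact fst t = x by rewrite tpair1.
have <- : lact snd t = y by rewrite tpair2.
by rewrite !tsp_addE; apply: lact_ext => c /=; rewrite addrC.
Qed.

Lemma tsp_add0 J : left_id (tsp_zero J) (@tsp_add J).
Proof.
move=> x; rewrite -{2}(lact_id x) -(tsp_zeroE J x) -{2}(lact_id x) tsp_addE.
by apply: lact_ext => c /=; rewrite add0r.
Qed.

Lemma tsp_addN J : left_inverse (tsp_zero J) (@tsp_opp J) (@tsp_add J).
Proof.
move=> x; rewrite -(tsp_zeroE J x) -{2}(lact_id x) tsp_addE.
by apply: lact_ext => c /=; rewrite scaleN1r addNr.
Qed.

HB.instance Definition _ J := gen_eqMixin (T J).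
HB.instance Definition _ J := gen_choiceMixin (T J).
HB.instance Definition _ J := GRing.isZmodule.Build (T J)
  (@tsp_addA J) (@tsp_addC J) (@tsp_add0 J) (@tsp_addN J).

Lemma tsp_scaleA J a b (x : T J) : tsp_scale a (tsp_scale b x) = tsp_scale (a * b) x.
Proof. by rewrite /tsp_scale lact_comp; apply: lact_ext => c /=; rewrite scalerA. Qed.
Lemma tsp_scale1 J : left_id 1 (@tsp_scale J).
Proof.
by move=> x; rewrite -{2}(lact_id x); apply: lact_ext => c /=; rewrite scale1r.
Qed.
Lemma tsp_scaleDr J : right_distributive (@tsp_scale J) +%R.
Proof.
move=> a x y; pose t := tpair hF x y.
have <- : lact fst t = x by rewrite tpair1.
have <- : lact snd t = y by rewrite tpair2.
change (tsp_scale a (tsp_add (lact fst t) (lact snd t)) =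
  tsp_add (tsp_scale a (lact fst t)) (tsp_scale a (lact snd t))).
by rewrite tsp_addE !tsp_scaleE tsp_addE; apply: lact_ext => c /=; rewrite scalerDr.
Qed.
Lemma tsp_scaleDl J (x : T J) : {morph (@tsp_scale J)^~ x : a b / a + b}.
Proof.
move=> a b; change (tsp_scale (a + b) x = tsp_add (tsp_scale a x) (tsp_scale b x)).
by rewrite /tsp_scale tsp_addE; apply: lact_ext => c /=; rewrite scalerDl.
Qed.
HB.instance Definition _ J := GRing.Zmodule_isLmodule.Build k (T J)
  (@tsp_scaleA J) (@tsp_scale1 J) (@tsp_scaleDr J) (@tsp_scaleDl J).

Lemma lact_addr J J' (u v : {linear J -> J'}) (t : T J) :
  lact (u \+ v : {linear J -> J'}) t = (lact u t : T J') + lact v t.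
Proof. by rewrite -tsp_addE. Qed.

Lemma lact_sum J J' n (u : 'I_n -> {linear J -> J'}) (w : {linear J -> J'}) (t : T J) :
  (forall v, w v = \sum_i u i v) -> lact w t = \sum_i (lact (u i) t : T J').
Proof.
elim: n u w => [|n IH] u w wE.
  rewrite big_ord0 -[RHS](tsp_zeroE J' t); apply: lact_ext => v /=.
  by rewrite wE big_ord0.
rewrite big_ord_recr /= -(IH _ (w \- u ord_max)) => [|v /=]; last first.
  by rewrite wE big_ord_recr /= addrK.
by rewrite -lact_addr; apply: lact_ext => v /=; rewrite subrK.
Qed.

End VectorTangent.

Section NaturalMaps.
Variables (k : fieldType).

(** Naturality in [J] forces linearity, since addition and scaling are
    themselves induced by linear maps; the base rings may differ. *)
Lemma natural_linear (R R' : comNzRingType) (pi : {rmorphism R -> k})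
    (pi' : {rmorphism R' -> k}) (F : functor pi) (G : functor pi')
    (hF : pointwise_homogeneous F) (hG : pointwise_homogeneous G)
    (phi : forall J : vectType k, F (sqzobj pi J) -> G (sqzobj pi' J)) :
  (forall (J J' : vectType k) (u : {linear J -> J'}) x, phi _ (lact u x) = lact u (phi _ x)) ->
  forall J, linear (phi J : tsp hF J -> tsp hG J).
Proof.
move=> phi_nat J a x y; pose t := tpair hF x y.
have <- : lact fst t = x by rewrite tpair1.
have <- : lact snd t = y by rewrite tpair2.
change (phi _ (tsp_add (hF := hF) (tsp_scale (hF := hF) a (lact fst t)) (lact snd t)) =
  tsp_add (hF := hG) (tsp_scale (hF := hG) a (phi _ (lact fst t))) (phi _ (lact snd t))).
by rewrite !tsp_scaleE !tsp_addE !phi_nat tsp_scaleE tsp_addE.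
Qed.

Variables (R : comNzRingType) (pi : {rmorphism R -> k}).

Section Lact.
Variables (F : functor pi) (hF : pointwise_homogeneous F).

Lemma lact_linear (J J' : vectType k) (u : {linear J -> J'}) :
  linear (lact u : tsp hF J -> tsp hF J').
Proof.
move=> a x y; pose t := tpair hF x y.
have <- : lact fst t = x by rewrite tpair1.
have <- : lact snd t = y by rewrite tpair2.
change (lact u (tsp_add (hF := hF) (tsp_scale (hF := hF) a (lact fst t)) (lact snd t)) =
  tsp_add (hF := hF) (tsp_scale (hF := hF) a (lact u (lact fst t))) (lact u (lact snd t))).
rewrite !tsp_scaleE tsp_addE !lact_comp tsp_addE.
by apply: lact_ext => z; rewrite /= linearP.
Qed.

Definition tsp_map (J J' : vectType k) (u : {linear J -> J'}) :
  tsp hF J -> tsp hF J' := lact u.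
HB.instance Definition _ J J' u :=
  GRing.isLinear.Build k (tsp hF J) (tsp hF J') _ (@tsp_map J J' u) (lact_linear u).

Lemma lact0 (J J' : vectType k) (u : {linear J -> J'}) :
  lact u (0 : tsp hF J) = (0 : tsp hF J').
Proof. exact: linear0 (tsp_map u). Qed.
Lemma lactD (J J' : vectType k) (u : {linear J -> J'}) (x y : tsp hF J) :
  lact u (x + y) = (lact u x : tsp hF J') + lact u y.
Proof. exact: linearD (tsp_map u) _ _. Qed.
End Lact.

(** The homogeneity isomorphism [H (k + J + J) = H (k + J) * H (k + J)] splits
    [phi x y] into the parts depending on [x] and on [y] only. *)
Lemma natural_biadditive (F G H : functor pi)
    (hF : pointwise_homogeneous F) (hG : pointwise_homogeneous G)
    (hH : pointwise_homogeneous H)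
    (phi : forall J : vectType k, F (sqzobj pi J) -> G (sqzobj pi J) -> H (sqzobj pi J)) :
  (forall (J J' : vectType k) (u : {linear J -> J'}) x y,
    phi _ (lact u x) (lact u y) = lact u (phi _ x y)) ->
  forall J (x : tsp hF J) (y : tsp hG J),
    phi _ x y = (phi _ x (0 : tsp hG J) : tsp hH J) + phi _ (0 : tsp hF J) y.
Proof.
move=> phi_nat J x y.
pose f1 (z : J) : (J * J)%type := (z, 0).
pose f2 (z : J) : (J * J)%type := (0, z).
have f1L : linear f1 by move=> a z t; congr pair; rewrite /= scaler0 addr0.
have f2L : linear f2 by move=> a z t; congr pair; rewrite /= scaler0 addr0.
pose i1 : {linear J -> (J * J)%type} := HB.pack f1 (GRing.isLinear.Build _ _ _ _ f1 f1L).
pose i2 : {linear J -> (J * J)%type} := HB.pack f2 (GRing.isLinear.Build _ _ _ _ f2 f2L).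
pose s : tsp hH _ := phi _ (lact i1 x) (lact i2 y).
pose p1 : {linear (J * J)%type -> J} := fst.
pose p2 : {linear (J * J)%type -> J} := snd.
have e1 : lact p1 s = phi J x (0 : tsp hG J).
  rewrite /s -phi_nat !lact_comp -{2}(lact_id x) -[X in _ = phi _ _ X](tsp_zeroE hG J y).
  by congr (phi _ _ _); apply: lact_ext.
have e2 : lact p2 s = phi J (0 : tsp hF J) y.
  rewrite /s -phi_nat !lact_comp -{2}(lact_id y) -[X in _ = phi _ X _](tsp_zeroE hF J x).
  by congr (phi _ _ _); apply: lact_ext.
rewrite -e1 -e2 -lact_addr /s -phi_nat !lact_comp -{1}(lact_id x) -{1}(lact_id y).
by congr (phi _ _ _); apply: lact_ext => z; rewrite /= ?addr0 ?add0r.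
Qed.

End NaturalMaps.
Arguments tsp_map {k R pi F} hF {J J'} u _.

Section Coordinates.
Variables (k : fieldType) (n : nat).

Definition rcoord (i : 'I_n) (v : 'rV[k]_n) : k^o := v 0 i.
Lemma rcoord_linear i : linear (rcoord i).
Proof. by move=> a u v; rewrite /rcoord !mxE. Qed.
HB.instance Definition _ i := GRing.isLinear.Build k 'rV[k]_n k^o _ (rcoord i) (rcoord_linear i).

Definition rinj (J : vectType k) (z : J) (a : k^o) : J := a *: z.
Lemma rinj_linear (J : vectType k) (z : J) : linear (rinj z).
Proof. by move=> a u v; rewrite /rinj scalerDl scalerA. Qed.
HB.instance Definition _ (J : vectType k) (z : J) :=
  GRing.isLinear.Build k k^o J _ (rinj z) (rinj_linear z).

Variables (R : comNzRingType) (pi : {rmorphism R -> k}).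
Variables (F : functor pi) (hF : pointwise_homogeneous F).

Lemma row_sum (J : vectType k) (u : {linear 'rV[k]_n -> J}) v :
  u v = \sum_i rinj (u (delta_mx 0 i)) (rcoord i v).
Proof.
by rewrite {1}(row_sum_delta v) linear_sum; apply: eq_bigr => i _; rewrite linearZ.
Qed.

Lemma lact_coord (l : {linear 'rV[k]_n -> k^o}) (x : tsp hF 'rV[k]_n) :
  lact l x = \sum_i (l (delta_mx 0 i) : k) *: (lact (rcoord i) x : tsp hF k^o).
Proof.
rewrite (lact_sum (hF := hF) (u := fun i => rinj (l (delta_mx 0 i)) \o rcoord i));
  last exact: row_sum.
apply: eq_bigr => i _; rewrite -lact_comp; apply: lact_ext => a.
exact: mulrC.
Qed.

Lemma lact_assemble (v : 'I_n -> tsp hF k^o) :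
  exists x : tsp hF 'rV[k]_n, forall i, lact (rcoord i) x = v i.
Proof.
exists (\sum_i tsp_map hF (rinj (delta_mx 0 i : 'rV[k]_n)) (v i)) => i.
rewrite -/(tsp_map hF _ _) linear_sum (bigD1 i) //= big1 => [|l ne].
  rewrite addr0 /tsp_map lact_comp -[RHS]lact_id; apply: lact_ext => a.
  by rewrite /= /rcoord /rinj !mxE !eqxx mulr1.
rewrite /tsp_map lact_comp -[RHS](tsp_zeroE hF _ (v l)); apply: lact_ext => a.
by rewrite /= /rcoord /rinj !mxE eqxx eq_sym (negbTE ne) mulr0.
Qed.

Lemma lact_separate (x y : tsp hF 'rV[k]_n) :
  (forall l : {linear 'rV[k]_n -> k^o}, lact l x = lact l y) -> x = y.
Proof.
move=> xy; rewrite -[x]lact_id -[y]lact_id.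
rewrite !(lact_sum (hF := hF) (u := fun i => rinj (delta_mx 0 i : 'rV[k]_n) \o rcoord i)) //;
  try by move=> v; rewrite {1}(row_sum_delta v).
by apply: eq_bigr => i _; rewrite -!lact_comp xy.
Qed.
End Coordinates.

(** * Trivial extensions and the torsor structure of fibres *)

Section TrivialExtension.
Variables (R : comNzRingType) (k : fieldType) (pi : {rmorphism R -> k}).

Section Ring.
Variables (A : art pi) (V : vectType k).

(** The ring [A + V], in which [A] acts on the square-zero ideal [V] through
    the residue field: the fibre product of [A] and [k + V] over [k]. *)
Definition triv : Type := (A * V)%type.
HB.instance Definition _ := GRing.Zmodule.copy triv (A * V)%type.

Definition triv_one : triv := (1, 0).
Definition triv_mul (x y : triv) : triv :=
  (x.1 * y.1, art_res A x.1 *: y.2 + art_res A y.1 *: x.2).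

Lemma triv_mulA : associative triv_mul.
Proof.
move=> [a x] [b y] [c z]; congr pair; rewrite /= ?mulrA //.
rewrite !rmorphM !scalerDr !scalerA addrA.
by rewrite (mulrC (art_res A c) (art_res A a)) (mulrC (art_res A c) (art_res A b)).
Qed.
Lemma triv_mulC : commutative triv_mul.
Proof. by move=> [a x] [b y]; congr pair; [exact: mulrC|exact: addrC]. Qed.
Lemma triv_mul1 : left_id triv_one triv_mul.
Proof.
by move=> [a x]; congr pair; rewrite /= ?mul1r // rmorph1 scale1r scaler0 addr0.
Qed.
Lemma triv_mulDl : left_distributive triv_mul +%R.
Proof.
move=> [a x] [b y] [c z]; congr pair; rewrite /= ?mulrDl // rmorphD.
by rewrite scalerDl scalerDr addrACA.
Qed.
Lemma triv_one_neq0 : triv_one != 0.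
Proof. by apply/eqP => -[/eqP]; rewrite oner_eq0. Qed.
HB.instance Definition _ := GRing.Zmodule_isComNzRing.Build triv
  triv_mulA triv_mulC triv_mul1 triv_mulDl triv_one_neq0.

Definition triv_in (a : A) : triv := (a, 0).
Lemma triv_in_add : zmod_morphism triv_in.
Proof. by move=> a b; congr pair; rewrite /= subr0. Qed.
Lemma triv_in_mul : monoid_morphism triv_in.
Proof. by split=> // a b; congr pair; rewrite /= !scaler0 addr0. Qed.
HB.instance Definition _ := GRing.isZmodMorphism.Build A triv triv_in triv_in_add.
HB.instance Definition _ := GRing.isMonoidMorphism.Build A triv triv_in triv_in_mul.

Definition triv_fst (x : triv) : A := x.1.
Lemma triv_fst_add : zmod_morphism triv_fst. Proof. by []. Qed.
Lemma triv_fst_mul : monoid_morphism triv_fst. Proof. by []. Qed.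
HB.instance Definition _ := GRing.isZmodMorphism.Build triv A triv_fst triv_fst_add.
HB.instance Definition _ := GRing.isMonoidMorphism.Build triv A triv_fst triv_fst_mul.

Definition triv_sqz (x : triv) : sqz V := (art_res A x.1, x.2).
Lemma triv_sqz_add : zmod_morphism triv_sqz.
Proof. by move=> x y; congr pair; rewrite /= rmorphB. Qed.
Lemma triv_sqz_mul : monoid_morphism triv_sqz.
Proof. by split=> [|x y]; congr pair; rewrite /= ?rmorph1 ?rmorphM. Qed.
HB.instance Definition _ := GRing.isZmodMorphism.Build triv (sqz V) triv_sqz triv_sqz_add.
HB.instance Definition _ := GRing.isMonoidMorphism.Build triv (sqz V) triv_sqz triv_sqz_mul.

Lemma triv_res_str r : (art_res A \o triv_fst) ((triv_in \o art_str A) r) = pi r.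
Proof. by rewrite /= art_res_str. Qed.
Lemma triv_res_surj (c : k) : exists x, (art_res A \o triv_fst) x = c.
Proof. by have [x hx] := art_res_surj A c; exists (triv_in x). Qed.
Lemma triv_local : is_local triv.
Proof.
apply: (@local_of_res k triv (art_res A \o triv_fst)) => -[a x] /= a0.
have [b ba] := art_unit a0; have e := congr1 (art_res A) ba.
rewrite rmorphM rmorph1 in e.
exists (b, - (art_res A b * art_res A b) *: x); congr pair => //=.
by rewrite scaleNr scalerN scalerA mulrA [art_res A a * _]mulrC e mul1r subrr.
Qed.
(** A chain of ideals is stationary once its images in [A] and its traces on
    [V] are. *)
Lemma triv_artinian : is_artinian triv.
Proof.
move=> I idI decI.
have dec m n x : (m <= n)%N -> I n x -> I m x.
  move=> /subnK <-; elim: (n - m)%N => // j IH; rewrite addSn => /decI; exact: IH.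
have [n|n a [v]|N hN] := @art_artinian _ _ _ A (fun n a => exists v, I n (a, v)).
- have [I0 ID IM] := idI n; split; first by exists 0.
    by move=> a b [v Iv] [w Iw]; exists (v + w); exact: ID Iv Iw.
  move=> a b [v Iv]; exists (art_res A a *: v).
  have -> : (a * b, art_res A a *: v) = triv_in a * (b, v) :> triv.
    by congr pair; rewrite /= scaler0 addr0.
  exact: IM.
- by move=> /decI h; exists v.
have [N' hN'] : exists N', forall n v, (N' <= n)%N -> I N' (0, v) -> I n (0, v).
  apply: (@subspace_dcc k V (fun n v => I n (0, v))) => [n|n a x y Ix Iy|n x].
  - by have [] := idI n.
  - have [_ ID IM] := idI n; have [b hb] := art_res_surj A a.
    have -> : (0, a *: x + y) = triv_in b * (0, x) + (0, y) :> triv.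
      by congr pair; rewrite /= ?mulr0 ?addr0 // scaler0 addr0 hb.
    exact: ID (IM _ _ Ix) Iy.
  - exact: decI.
exists (maxn N N') => n [a v] le_n Iv.
have [le1 le2] : (N <= n)%N /\ (N' <= n)%N by apply/andP; rewrite -geq_max.
have [w Iw] : exists w, I n (a, w).
  by apply: hN => //; exists v; apply: dec Iv; rewrite leq_maxl.
have -> : (a, v) = (0, v - w) + (a, w) :> triv.
  by congr pair; rewrite /= ?add0r // subrK.
have [_ ID _] := idI n; apply: ID => //; apply: hN' => //.
apply: (@dec _ (maxn N N')); first by rewrite leq_maxr.
have -> : (0, v - w) = (a, v) - (a, w) :> triv by congr pair; rewrite /= subrr.
exact: is_idealB (idI _) Iv (dec _ _ _ le_n Iw).
Qed.

Definition triv_art : art pi :=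
  @Art R k pi triv (triv_in \o art_str A) (art_res A \o triv_fst)
    triv_res_str triv_res_surj triv_local triv_artinian.

Definition htriv_in : hom A triv_art :=
  @Hom R k pi A triv_art triv_in (fun=> erefl) (fun=> erefl).
Definition htriv_fst : hom triv_art A :=
  @Hom R k pi triv_art A triv_fst (fun=> erefl) (fun=> erefl).
Lemma triv_sqz_str r : triv_sqz (art_str triv_art r) = art_str (sqzobj pi V) r.
Proof. by congr pair; rewrite /= art_res_str. Qed.
Definition htriv_sqz : hom triv_art (sqzobj pi V) :=
  @Hom R k pi triv_art (sqzobj pi V) triv_sqz triv_sqz_str (fun=> erefl).

Lemma triv_fibre_product :
  is_fibre_product (hres A) (hsqz_out pi V) htriv_fst htriv_sqz.
Proof.
split=> // a [c v] /= ac; exists ((a, v) : triv); split.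
  by split=> //; congr pair.
by move=> [a' v'] /= [e [_ <-]]; rewrite -e.
Qed.
End Ring.

Section Map.
Variables (A A' : art pi) (V V' : vectType k) (g : hom A A') (u : {linear V -> V'}).
Definition triv_map (x : triv A V) : triv A' V' := (g x.1, u x.2).
Lemma triv_map_add : zmod_morphism triv_map.
Proof. by move=> x y; congr pair; rewrite /= ?rmorphB ?linearB. Qed.
Lemma triv_map_mul : monoid_morphism triv_map.
Proof.
split=> [|x y]; congr pair; rewrite /= ?rmorph1 ?linear0 ?rmorphM //.
by rewrite linearD !linearZ !hom_res.
Qed.
HB.instance Definition _ :=
  GRing.isZmodMorphism.Build (triv A V) (triv A' V') triv_map triv_map_add.
HB.instance Definition _ :=
  GRing.isMonoidMorphism.Build (triv A V) (triv A' V') triv_map triv_map_mul.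
Lemma triv_map_str r :
  triv_map (art_str (triv_art A V) r) = art_str (triv_art A' V') r.
Proof. by congr pair; rewrite /= ?linear0 // hom_str. Qed.
Lemma triv_map_res x :
  art_res (triv_art A' V') (triv_map x) = art_res (triv_art A V) x.
Proof. exact: hom_res. Qed.
Definition htriv_map : hom (triv_art A V) (triv_art A' V') :=
  @Hom R k pi (triv_art A V) (triv_art A' V') triv_map triv_map_str triv_map_res.
End Map.

Section Act.
Variables (A B : art pi) (f : hom A B) (V : vectType k) (j : {additive V -> A}).
Hypothesis fr : is_framed f j.

Lemma framed_res v : art_res A (j v) = 0.
Proof. by rewrite -(hom_res f) (framed_ker0 v fr) rmorph0. Qed.

(** Multiplicative because the kernel of [f] is killed by the maximal ideal, in
    which it is contained. *)
Definition act_fun (x : triv A V) : A := x.1 + j x.2.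
Lemma act_fun_add : zmod_morphism act_fun.
Proof. by move=> x y; rewrite /act_fun /= raddfB opprD addrACA. Qed.
Lemma act_fun_mul : monoid_morphism act_fun.
Proof.
split=> [|[a x] [b y]]; rewrite /act_fun /=; first by rewrite raddf0 addr0.
rewrite mulrDl !mulrDr !(fr_scale fr) framed_res scale0r raddf0 addr0.
by rewrite mulrC [j x * b]mulrC (fr_scale fr) raddfD addrA [b * a]mulrC.
Qed.
HB.instance Definition _ := GRing.isZmodMorphism.Build (triv A V) A act_fun act_fun_add.
HB.instance Definition _ := GRing.isMonoidMorphism.Build (triv A V) A act_fun act_fun_mul.
Lemma act_str r : act_fun (art_str (triv_art A V) r) = art_str A r.
Proof. by rewrite /act_fun /= raddf0 addr0. Qed.
Lemma act_res x : art_res A (act_fun x) = art_res (triv_art A V) x.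
Proof. by rewrite rmorphD framed_res addr0. Qed.
Definition hact : hom (triv_art A V) A :=
  @Hom R k pi (triv_art A V) A act_fun act_str act_res.

(** Together with the projection, [hact] identifies [A + V] with [A x_B A]. *)
Lemma act_fibre_product : is_fibre_product f f (htriv_fst A V) hact.
Proof.
split=> [[a v]|a b fab] /=.
  by rewrite /act_fun /= rmorphD (framed_ker0 v fr) addr0.
have /(fr_ker fr) [v hv] : f (b - a) = 0 by rewrite rmorphB fab subrr.
exists ((a, v) : triv A V); split.
  by split=> //; rewrite /act_fun /= -hv addrC subrK.
move=> [a' v'] /= [e]; rewrite /triv_fst /= in e; rewrite e /act_fun /= => b'.
by congr pair; apply: (fr_inj fr); rewrite -hv -b' addrAC subrr add0r.
Qed.

(** The first of two successive translations, the second vector being kept for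
    later. *)
Definition act1_fun (x : triv A (V * V)%type) : triv A V := (x.1 + j x.2.1, x.2.2).
Lemma act1_fun_add : zmod_morphism act1_fun.
Proof. by move=> x y; congr pair; rewrite /= raddfB opprD addrACA. Qed.
Lemma act1_fun_mul : monoid_morphism act1_fun.
Proof.
split=> [|x y]; congr pair; rewrite /=.
- by rewrite raddf0 addr0.
- exact: (act_fun_mul.2 (x.1, x.2.1) (y.1, y.2.1)).
- by rewrite !rmorphD !framed_res !addr0.
Qed.
HB.instance Definition _ :=
  GRing.isZmodMorphism.Build (triv A (V * V)%type) (triv A V) act1_fun act1_fun_add.
HB.instance Definition _ :=
  GRing.isMonoidMorphism.Build (triv A (V * V)%type) (triv A V) act1_fun act1_fun_mul.
Lemma act1_str r :
  act1_fun (art_str (triv_art A (V * V)%type) r) = art_str (triv_art A V) r.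
Proof. by congr pair; rewrite /= raddf0 addr0. Qed.
Lemma act1_res x :
  art_res (triv_art A V) (act1_fun x) = art_res (triv_art A (V * V)%type) x.
Proof. by rewrite /= /triv_fst rmorphD framed_res addr0. Qed.
Definition hact1 : hom (triv_art A (V * V)%type) (triv_art A V) :=
  @Hom R k pi (triv_art A (V * V)%type) (triv_art A V) act1_fun act1_str act1_res.
End Act.

End TrivialExtension.

Section Shift.
Variables (R : comNzRingType) (k : fieldType) (pi : {rmorphism R -> k}).

Section Pair.
Variables (F : functor pi) (hF : homogeneous F) (A : art pi).
Local Notation T := (tsp (homogeneous_pointwise hF)).

Lemma gpair_ex (V : vectType k) (x : F A) (v : T V) : exists t : F (triv_art A V),
  fmap F (htriv_fst A V) t = x /\ fmap F (htriv_sqz A V) t = v.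
Proof.
have [eS _] := hF (triv_fibre_product A V) (@hres_surj _ _ _ A).
by apply: eS; rewrite [LHS]fpt_uniq [RHS]fpt_uniq.
Qed.

Definition gpair (V : vectType k) (x : F A) (v : T V) := projT1 (cid (gpair_ex x v)).

Lemma gpair1 (V : vectType k) (x : F A) (v : T V) :
  fmap F (htriv_fst A V) (gpair x v) = x.
Proof. by rewrite /gpair; case: cid => t /= []. Qed.
Lemma gpair2 (V : vectType k) (x : F A) (v : T V) :
  fmap F (htriv_sqz A V) (gpair x v) = v.
Proof. by rewrite /gpair; case: cid => t /= []. Qed.

Lemma gpair_uniq (V : vectType k) (t : F (triv_art A V)) :
  gpair (fmap F (htriv_fst A V) t) (fmap F (htriv_sqz A V) t) = t.
Proof.
have [_ eI] := hF (triv_fibre_product A V) (@hres_surj _ _ _ A).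
by apply: eI; rewrite ?gpair1 ?gpair2.
Qed.
End Pair.

Variables (A B : art pi) (f : hom A B) (V : vectType k) (j : {additive V -> A}).
Hypothesis fr : is_framed f j.

Section Torsor.
Variables (F : functor pi) (hF : homogeneous F).
Local Notation T := (tsp (homogeneous_pointwise hF)).

(** As [A x_B A = A x_k (k + V)], homogeneity makes each non-empty fibre of
    [F A -> F B] a torsor under [F (k + V)]; [shift x v] is the action. *)
Definition shift (x : F A) (v : T V) : F A := fmap F (hact fr) (gpair x v).

Lemma shiftE (t : F (triv_art A V)) :
  shift (fmap F (htriv_fst A V) t) (fmap F (htriv_sqz A V) t) = fmap F (hact fr) t.
Proof. by rewrite /shift gpair_uniq. Qed.

Lemma fmap_shift x v : fmap F f (shift x v) = fmap F f x.
Proof.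
rewrite -{2}(gpair1 x v) /shift -!fmap_comp; apply: fmap_ext => t.
by have [e _] := act_fibre_product fr; exact: (esym (e t)).
Qed.

Lemma shift_ex x y : fmap F f x = fmap F f y -> exists v, y = shift x v.
Proof.
have [eS _] := hF (act_fibre_product fr) (fr_surj fr).
by move=> /eS [t [<- <-]]; exists (fmap F (htriv_sqz A V) t); rewrite shiftE.
Qed.

Lemma shift_inj x : injective (shift x).
Proof.
have [_ eI] := hF (act_fibre_product fr) (fr_surj fr).
move=> v w vw; rewrite -(gpair2 x v) -(gpair2 x w); congr (fmap _ _ _).
by apply: eI; rewrite ?gpair1.
Qed.

Lemma shift0 x : shift x 0 = x.
Proof.
have -> : (0 : T V) = fmap F (htriv_sqz A V) (fmap F (htriv_in A V) x).
  rewrite -fmap_comp -[LHS]/(fmap F (hsqz_in pi V) (fpt F)).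
  by rewrite -(fpt_uniq F (fmap F (hres A) x)) -fmap_comp; apply: fmap_ext.
have {1}-> : x = fmap F (htriv_fst A V) (fmap F (htriv_in A V) x).
  by rewrite -fmap_comp -[LHS](fmap_id F); apply: fmap_ext.
rewrite shiftE -fmap_comp -[RHS](fmap_id F); apply: fmap_ext => a.
by rewrite /= /act_fun /= raddf0 addr0.
Qed.

(** Both sides are the image of the single element of [F (A + V + V)] with
    components [x], [v] and [w]. *)
Lemma shiftD x v w : shift (shift x v) w = shift x (v + w).
Proof.
pose p1 : {linear (V * V)%type -> V} := fst.
pose p2 : {linear (V * V)%type -> V} := snd.
pose t : F (triv_art A (V * V)%type) := gpair (hF := hF) x (tpair (homogeneous_pointwise hF) v w).
have e1 : shift x v = fmap F (htriv_fst A V) (fmap F (hact1 fr) t).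
  rewrite -fmap_comp (fmap_ext F _ (hcomp (hact fr) (htriv_map (hid A) p1))) // fmap_comp.
  rewrite -shiftE -!fmap_comp; congr (shift _ _).
    by rewrite -[LHS](gpair1 (hF := hF) x (tpair (homogeneous_pointwise hF) v w)); apply: fmap_ext.
  rewrite -[LHS](tpair1 (homogeneous_pointwise hF) v w) /lact.
  by rewrite -[X in fmap _ _ X](gpair2 (hF := hF) x) -fmap_comp; apply: fmap_ext.
have e2 : w = fmap F (htriv_sqz A V) (fmap F (hact1 fr) t).
  rewrite -fmap_comp -[LHS](tpair2 (homogeneous_pointwise hF) v w) /lact.
  rewrite -[X in fmap _ _ X](gpair2 (hF := hF) x) -fmap_comp; apply: fmap_ext => -[a c].
  by congr pair; rewrite /= rmorphD (framed_res fr) addr0.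
rewrite e1 {1}e2 shiftE -fmap_comp.
rewrite (fmap_ext F _ (hcomp (hact fr) (htriv_map (hid A) (p1 \+ p2)))); last first.
  by case=> a [c d]; rewrite /= /act_fun /= raddfD addrA.
rewrite fmap_comp -shiftE -!fmap_comp; congr (shift _ _).
  by rewrite -[RHS](gpair1 (hF := hF) x (tpair (homogeneous_pointwise hF) v w)); apply: fmap_ext.
rewrite -[RHS]/(lact _ (tpair (homogeneous_pointwise hF) v w)) /lact.
by rewrite -[X in _ = fmap _ _ X](gpair2 (hF := hF) x) -fmap_comp; apply: fmap_ext.
Qed.

End Torsor.

Section Natural.
Variables (F G H : functor pi).
Variables (hF : homogeneous F) (hG : homogeneous G) (hH : homogeneous H).

Lemma shift_map1 (phi : forall A, F A -> G A) :
  (forall A B (g : hom A B) x, fmap G g (phi A x) = phi B (fmap F g x)) ->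
  forall (x : F A) (v : tsp (homogeneous_pointwise hF) V),
  phi A (shift x v) = shift (hF := hG) (phi A x) (phi _ v).
Proof.
move=> nat x v; rewrite /shift -nat; congr (fmap _ _ _).
by rewrite -[LHS](gpair_uniq hG) !nat gpair1 gpair2.
Qed.

Lemma shift_map2 (phi : forall A, F A -> G A -> H A) :
  (forall A B (g : hom A B) x y, fmap H g (phi A x y) = phi B (fmap F g x) (fmap G g y)) ->
  forall (x : F A) (v : tsp (homogeneous_pointwise hF) V)
    (y : G A) (w : tsp (homogeneous_pointwise hG) V),
  phi A (shift x v) (shift y w) = shift (hF := hH) (phi A x y) (phi _ v w).
Proof.
move=> nat x v y w; rewrite /shift -nat; congr (fmap _ _ _).
by rewrite -[LHS](gpair_uniq hH) !nat !gpair1 !gpair2.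
Qed.
End Natural.

End Shift.

Section ShiftBase.
Variables (R : comNzRingType) (k : fieldType) (pi : {rmorphism R -> k}).
Variables (F : functor pi) (hF : homogeneous F).
Variables (A B : art pi) (f : hom A B) (V : vectType k) (j : {additive V -> A}).
Variables (A' B' : art pi) (f' : hom A' B') (V' : vectType k) (j' : {additive V' -> A'}).

Lemma shift_fmap (fr : is_framed f j) (fr' : is_framed f' j')
    (g : hom A A') (u : {linear V -> V'}) : (forall v, g (j v) = j' (u v)) ->
  forall (x : F A) (v : tsp (homogeneous_pointwise hF) V),
  fmap F g (shift fr x v) = shift fr' (hF := hF) (fmap F g x) (lact u v).
Proof.
move=> gj x v; rewrite /shift -fmap_comp.
rewrite (fmap_ext F _ (hcomp (hact fr') (htriv_map g u))) ?fmap_comp; last first.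
  by case=> a w; rewrite /= /act_fun /= rmorphD gj.
congr (fmap _ _ _); rewrite -[LHS](gpair_uniq hF) -!fmap_comp; congr gpair.
  by rewrite -{2}(gpair1 x v) -fmap_comp; apply: fmap_ext.
rewrite -{2}(gpair2 x v) /lact -fmap_comp; apply: fmap_ext => -[a w].
by congr pair; rewrite /= hom_res.
Qed.
End ShiftBase.

(** * Products and cofaces in low degrees *)

Section LowDegrees.
Variables (R : comNzRingType) (k : fieldType) (pi : {rmorphism R -> k}).
Variable E : sdc pi.
Implicit Types A B : art pi.

Definition mul02 A (x : E 0 A) (y : E 2 A) : E 2 A := sdc_mul x y.
Definition mul20 A (x : E 2 A) (y : E 0 A) : E 2 A := sdc_mul x y.
Definition mul12 A (x : E 1 A) (y : E 2 A) : E 3 A := sdc_mul x y.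
Definition mul21 A (x : E 2 A) (y : E 1 A) : E 3 A := sdc_mul x y.

Lemma mulA111 A (x y z : E 1 A) : mul21 (mul11 x y) z = mul12 x (mul11 y z).
Proof. by have := sdc_mulA x y z; rewrite (eq_irrelevance (addnA 1 1 1) erefl). Qed.
Lemma mulA011 A (g : E 0 A) (x y : E 1 A) : mul11 (mul01 g x) y = mul02 g (mul11 x y).
Proof. by have := sdc_mulA g x y; rewrite (eq_irrelevance (addnA 0 1 1) erefl). Qed.
Lemma mulA101 A (x : E 1 A) (g : E 0 A) (y : E 1 A) :
  mul11 (mul10 x g) y = mul11 x (mul01 g y).
Proof. by have := sdc_mulA x g y; rewrite (eq_irrelevance (addnA 1 0 1) erefl). Qed.
Lemma mulA110 A (x y : E 1 A) (g : E 0 A) : mul20 (mul11 x y) g = mul11 x (mul10 y g).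
Proof. by have := sdc_mulA x y g; rewrite (eq_irrelevance (addnA 1 1 0) erefl). Qed.
Lemma mulA200 A (x : E 2 A) (g h : E 0 A) : mul20 (mul20 x g) h = mul20 x (mul00 g h).
Proof. by have := sdc_mulA x g h; rewrite (eq_irrelevance (addnA 2 0 0) erefl). Qed.
Lemma mulr1_20 A (x : E 2 A) : mul20 x (sdc_one E A) = x.
Proof. by have := sdc_mulr1 x; rewrite (eq_irrelevance (addn0 2) erefl). Qed.

Lemma mul12_d A (x y : E 1 A) : mul12 x (sdc_d 1 y) = sdc_d 2 (mul11 x y).
Proof.
by have := @sdc_mul_d _ _ _ E 1 1 1 A x y isT; rewrite (eq_irrelevance (addnS 1 1) erefl).
Qed.
Lemma mul21_d A (x y : E 1 A) : mul21 (sdc_d 1 x) y = sdc_d 1 (mul11 x y).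
Proof. exact: (@sdc_d_mul _ _ _ E 1 1 1 A x y isT). Qed.
Lemma mul02_d A (g : E 0 A) (x : E 1 A) : mul02 g (sdc_d 1 x) = sdc_d 1 (mul01 g x).
Proof.
by have := @sdc_mul_d _ _ _ E 0 1 1 A g x isT; rewrite (eq_irrelevance (addnS 0 1) erefl).
Qed.
Lemma mul20_d A (x : E 1 A) (g : E 0 A) : mul20 (sdc_d 1 x) g = sdc_d 1 (mul10 x g).
Proof. exact: (@sdc_d_mul _ _ _ E 1 0 1 A x g isT). Qed.

Local Notation hE := (sdc_homogeneous E).
Local Notation C n := (tsp (homogeneous_pointwise (hE n))).

Lemma cochain_one (V : vectType k) : (0 : C 0 V) = sdc_one E _.
Proof. by rewrite -(sdc_one_nat E (hsqz_in pi V)) (fpt_uniq (E 0) (sdc_one E _)). Qed.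

Lemma lact_mul m n (V V' : vectType k) (u : {linear V -> V'})
    (x : E m (sqzobj pi V)) (y : E n (sqzobj pi V)) :
  sdc_mul (lact u x) (lact u y) = lact u (sdc_mul x y).
Proof. by rewrite /lact sdc_mul_nat. Qed.

(** As [0] in degree one is [omega0], multiplication by it is an outer coface:
    products with a factor of degree one are computed by outer cofaces. *)
Lemma mul_split m n (V : vectType k) (x : C m V) (y : C n V) :
  sdc_mul x y = (sdc_mul x (0 : C n V) : C (m + n) V) + sdc_mul (0 : C m V) y.
Proof.
have h := @natural_biadditive k R pi (E m) (E n) (E (m + n))
  (homogeneous_pointwise (hE m)) (homogeneous_pointwise (hE n))
  (homogeneous_pointwise (hE (m + n))) (fun V => @sdc_mul _ _ _ E m n (sqzobj pi V))
  (fun V V' u x y => lact_mul u x y).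
exact (h V x y).
Qed.

Lemma mul00_split (V : vectType k) (x y : C 0 V) : mul00 x y = x + y.
Proof.
have -> : mul00 x y = (mul00 x (0 : C 0 V) : C 0 V) + mul00 (0 : C 0 V) y.
  exact: (@mul_split 0 0).
by rewrite (cochain_one V) mul1_00 mulr1_00.
Qed.
Lemma mul01_split (V : vectType k) (x : C 0 V) (y : C 1 V) :
  mul01 x y = (mul01 x (0 : C 1 V) : C 1 V) + y.
Proof.
have -> : mul01 x y = (mul01 x (0 : C 1 V) : C 1 V) + mul01 (0 : C 0 V) y.
  exact: (@mul_split 0 1).
by rewrite (cochain_one V) mul1_01.
Qed.
Lemma mul10_split (V : vectType k) (x : C 1 V) (y : C 0 V) :
  mul10 x y = x + (mul10 (0 : C 1 V) y : C 1 V).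
Proof.
have -> : mul10 x y = (mul10 x (0 : C 0 V) : C 1 V) + mul10 (0 : C 1 V) y.
  exact: (@mul_split 1 0).
by rewrite (cochain_one V) mulr1_10.
Qed.
Lemma mul11_split (V : vectType k) (x y : C 1 V) :
  mul11 x y = (mul11 x (0 : C 1 V) : C 2 V) + mul11 (0 : C 1 V) y.
Proof. exact: (@mul_split 1 1). Qed.
Lemma mul02_0 (V : vectType k) (y : C 2 V) : mul02 (0 : C 0 V) y = y.
Proof. by rewrite (cochain_one V); exact: sdc_mul1. Qed.
Lemma mul20_0 (V : vectType k) (x : C 2 V) : mul20 x (0 : C 0 V) = x.
Proof. by rewrite (cochain_one V) mulr1_20. Qed.

(** The differential with coefficients in [V], of which [diff] is the case
    [V = k]. *)
Definition diffV n (V : vectType k) (x : C n V) : C n.+1 V :=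
  \sum_(i < n.+2) (-1) ^+ i *: (coface i x : C n.+1 V).

Lemma diffVE n (x : C n k^o) : diffV x = diff (x : cochain E n).
Proof. by []. Qed.

Lemma diffV_linear n (V : vectType k) : linear (@diffV n V).
Proof.
move=> a x y; rewrite /diffV scaler_sumr -big_split /=; apply: eq_bigr => i _.
have le_in : (i <= n.+1)%N by rewrite -ltnS.
have L := @natural_linear k R R pi pi (E n) (E n.+1) (homogeneous_pointwise (hE n))
  (homogeneous_pointwise (hE n.+1)) (@coface _ _ _ E n i)
  (fun V V' u z => coface_nat u z le_in).
by rewrite L scalerDr !scalerA (mulrC a).
Qed.
HB.instance Definition _ n V :=
  GRing.isLinear.Build k (C n V) (C n.+1 V) _ (@diffV n V) (@diffV_linear n V).

Lemma lact_diffV n (V V' : vectType k) (u : {linear V -> V'}) (x : C n V) :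
  lact u (diffV x) = diffV (lact u x).
Proof.
rewrite -/(tsp_map (homogeneous_pointwise (hE n.+1)) u (diffV x)) /diffV linear_sum.
apply: eq_bigr => i _; rewrite linearZ /= /tsp_map coface_nat //.
by rewrite -ltnS.
Qed.

Lemma diffV0E (V : vectType k) (x : C 0 V) :
  diffV x = (mul10 (0 : C 1 V) x : C 1 V) - (mul01 x (0 : C 1 V) : C 1 V).
Proof.
rewrite /diffV big_ord_recl big_ord1 expr0 scale1r expr1 scaleN1r; congr (_ - _).
by rewrite /coface /= (eq_irrelevance (addn1 0) erefl).
Qed.

Lemma diffV1E (V : vectType k) (x : C 1 V) :
  diffV x = (mul11 (0 : C 1 V) x : C 2 V) - (sdc_d 1 x : C 2 V) + mul11 x (0 : C 1 V).
Proof.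
rewrite /diffV !big_ord_recl big_ord0 addr0 expr0 scale1r expr1 scaleN1r addrA.
rewrite [_ ^+ _]expr2 mulrNN mul1r scale1r; congr (_ + _).
by rewrite /coface /= (eq_irrelevance (addn1 1) erefl).
Qed.

Lemma diffV2E (V : vectType k) (x : C 2 V) :
  diffV x = (mul12 (0 : C 1 V) x : C 3 V) - (sdc_d 1 x : C 3 V) + sdc_d 2 x
    - (mul21 x (0 : C 1 V) : C 3 V).
Proof.
rewrite /diffV !big_ord_recl big_ord0 addr0 expr0 scale1r expr1 scaleN1r !addrA.
rewrite [in X in _ + X + _]/= [X in _ + X *: _ + _]expr2 mulrNN mul1r scale1r.
rewrite [X in _ + X *: _]exprS [X in _ + (_ * X) *: _]expr2 mulrNN mulr1 mulr1 scaleN1r.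
congr (_ - _).
by rewrite /coface /= (eq_irrelevance (addn1 2) erefl).
Qed.

Section Extension.
Variables (A B : art pi) (f : hom A B) (V : vectType k) (j : {additive V -> A}).
Hypothesis fr : is_framed f j.
Local Notation sh n := (@shift _ _ _ A B f V j fr (E n) (hE n)).

Lemma shift_mul m n x v y w :
  sdc_mul (sh m x v) (sh n y w) = sh (m + n) (sdc_mul x y) (sdc_mul v w : C (m + n) V).
Proof.
have h := @shift_map2 _ _ _ _ _ _ _ _ fr (E m) (E n) (E (m + n)) (hE m) (hE n) (hE (m + n))
  (fun A => @sdc_mul _ _ _ E m n A) (fun A B g x y => sdc_mul_nat g x y).
exact: h.
Qed.

Lemma shift_d n i x v : (1 <= i <= n)%N ->
  sdc_d i (sh n x v) = sh n.+1 (sdc_d i x) (sdc_d i v : C n.+1 V).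
Proof.
move=> le_in; have h := @shift_map1 _ _ _ _ _ _ _ _ fr (E n) (E n.+1) (hE n) (hE n.+1)
  (fun A => @sdc_d _ _ _ E n i A) (fun A B g x => sdc_d_nat g x le_in).
exact: h.
Qed.

Lemma shift_mul00 x v y w :
  mul00 (sh 0 x v) (sh 0 y w) = sh 0 (mul00 x y) (v + w).
Proof. by rewrite -mul00_split; exact: (@shift_mul 0 0). Qed.
Lemma shift_mul01 x v y w : mul01 (sh 0 x v) (sh 1 y w) =
  sh 1 (mul01 x y) ((mul01 v (0 : C 1 V) : C 1 V) + w).
Proof. by rewrite -mul01_split; exact: (@shift_mul 0 1). Qed.
Lemma shift_mul10 x v y w : mul10 (sh 1 x v) (sh 0 y w) =
  sh 1 (mul10 x y) (v + mul10 (0 : C 1 V) w).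
Proof. by rewrite -mul10_split; exact: (@shift_mul 1 0). Qed.
Lemma shift_mul11 x v y w : mul11 (sh 1 x v) (sh 1 y w) =
  sh 2 (mul11 x y) ((mul11 v (0 : C 1 V) : C 2 V) + mul11 (0 : C 1 V) w).
Proof. by rewrite -mul11_split; exact: (@shift_mul 1 1). Qed.
Lemma shift_mul02 g y w : mul02 g (sh 2 y w) = sh 2 (mul02 g y) w.
Proof. by rewrite -[in LHS](shift0 fr (hE 0) g) -[w in RHS]mul02_0; exact: (@shift_mul 0 2). Qed.
Lemma shift_mul20 x v g : mul20 (sh 2 x v) g = sh 2 (mul20 x g) v.
Proof. by rewrite -[in LHS](shift0 fr (hE 0) g) -[v in RHS]mul20_0; exact: (@shift_mul 2 0). Qed.
Lemma shift_mul12 x y w : mul12 x (sh 2 y w) = sh 3 (mul12 x y) (mul12 (0 : C 1 V) w).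
Proof. by rewrite -[in LHS](shift0 fr (hE 1) x); exact: (@shift_mul 1 2). Qed.
Lemma shift_mul21 x v y : mul21 (sh 2 x v) y = sh 3 (mul21 x y) (mul21 v (0 : C 1 V)).
Proof. by rewrite -[in LHS](shift0 fr (hE 1) y); exact: (@shift_mul 2 1). Qed.
Lemma shift_mul10l x v g : mul10 (sh 1 x v) g = sh 1 (mul10 x g) v.
Proof.
rewrite -[in LHS](shift0 fr (hE 0) g) shift_mul10; congr (sh 1 _ _).
by rewrite (cochain_one V) [mul10 _ _]mulr1_10 addr0.
Qed.
Lemma shift_mul01l x v y : mul01 (sh 0 x v) y = sh 1 (mul01 x y) (mul01 v (0 : C 1 V)).
Proof. by rewrite -[in LHS](shift0 fr (hE 1) y) shift_mul01 addr0. Qed.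
Lemma shift_mul10r x y w : mul10 x (sh 0 y w) = sh 1 (mul10 x y) (mul10 (0 : C 1 V) w).
Proof. by rewrite -[in LHS](shift0 fr (hE 1) x) shift_mul10 add0r. Qed.

End Extension.

(** [E^0] is a group: invertibility lifts along small extensions, because the
    elements of [E^0 A] over [1] form a copy of the additive group of
    [E^0 (k + V)]. *)
Lemma E0_inverse A (g : E 0 A) :
  exists h, mul00 g h = sdc_one E A /\ mul00 h g = sdc_one E A.
Proof.
elim/art_ind: A g => [|A B f n j fr IH] g.
  by exists g; split; rewrite [LHS]fpt_uniq [RHS]fpt_uniq.
have [h' [gh' h'g]] := IH (fmap (E 0) f g).
have [h hh'] := @sdc_smooth _ _ _ E 0 _ _ f (fr_surj fr) h'.
have inv (u : E 0 A) : fmap (E 0) f u = sdc_one E B ->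
    exists u', mul00 u u' = sdc_one E A /\ mul00 u' u = sdc_one E A.
  rewrite -(sdc_one_nat E f) => /esym /(shift_ex fr (hE 0)) [v ->].
  exists (shift fr (hF := hE 0) (sdc_one E A) (- v)).
  by rewrite !shift_mul00 subrr addNr shift0 mul1_00.
have [u [ghu _]] : exists u, mul00 (mul00 g h) u = sdc_one E A /\
    mul00 u (mul00 g h) = sdc_one E A.
  by apply: inv; rewrite fmap_mul00 hh'.
have [u' [_ u'hg]] : exists u, mul00 (mul00 h g) u = sdc_one E A /\
    mul00 u (mul00 h g) = sdc_one E A.
  by apply: inv; rewrite fmap_mul00 hh'.
rewrite mulA000 in ghu; rewrite -mulA000 in u'hg.
exists (mul00 h u); split=> //.
suff -> : mul00 h u = mul00 u' h by [].
by rewrite -[RHS]mulr1_00 -ghu -mulA000 u'hg mul1_00.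
Qed.

(** The form of the conjugation equation used from here on: it involves no
    inverse, so it commutes with shifts and with gluing. *)
Lemma conjugatesP A (g : E 0 A) (w w' : E 1 A) :
  conjugates g w w' <-> mul01 g w = mul10 w' g.
Proof.
split=> [[h [gh hg <-]]|e]; first by rewrite mulA100 hg mulr1_10.
have [h [gh hg]] := E0_inverse g; exists h; split=> //.
by rewrite e mulA100 gh mulr1_10.
Qed.

Lemma mul20_inj A (g : E 0 A) : injective (fun x : E 2 A => mul20 x g).
Proof.
have [h [gh _]] := E0_inverse g.
by move=> x y /(congr1 (fun z : E 2 A => mul20 z h)); rewrite /= !mulA200 gh !mulr1_20.
Qed.

End LowDegrees.

(** * Defects of the Maurer-Cartan and conjugation equations *)

Section Obstruction.
Variables (R : comNzRingType) (k : fieldType) (pi : {rmorphism R -> k}).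
Variable E : sdc pi.
Local Notation hE := (sdc_homogeneous E).
Local Notation C n := (tsp (homogeneous_pointwise (hE n))).

Section Extension.
Variables (A B : art pi) (f : hom A B) (V : vectType k) (j : {additive V -> A}).
Hypothesis fr : is_framed f j.
Local Notation sh n := (@shift _ _ _ A B f V j fr (E n) (hE n)).

(** The curvature of [x] when [x] lifts a Maurer-Cartan element of [B]. *)
Definition mc_defect (x : E 1 A) (o : C 2 V) : Prop :=
  mul11 x x = sh 2 (sdc_d 1 x) o.

Lemma mc_defect_ex x : is_mc (fmap (E 1) f x) -> exists o, mc_defect x o.
Proof.
move=> mcx; apply: (shift_ex fr (hE 2)).
by rewrite fmap_mul11 mcx sdc_d_nat.
Qed.

Lemma mc_defect_uniq x o o' : mc_defect x o -> mc_defect x o' -> o = o'.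
Proof. by move=> h h'; apply: (shift_inj (fr := fr) (x := sdc_d 1 x)); rewrite -h. Qed.

Lemma mc_defect0 x : mc_defect x 0 <-> is_mc x.
Proof. by rewrite /mc_defect shift0. Qed.

Lemma mc_defect_shift x o v :
  mc_defect x o -> mc_defect (sh 1 x v) (o + diffV v).
Proof.
rewrite /mc_defect shift_mul11 => ->; rewrite shift_d // !shiftD; congr (sh 2 _ _).
rewrite diffV1E [RHS]addrCA; congr (_ + _).
by rewrite [RHS]addrA [X in _ = X + _]addrC subrK addrC.
Qed.

(** Both bracketings of [x * x * x] express the outer cofaces of the defect. *)
Lemma mc_defect_cocycle x o : mc_defect x o -> diffV o = 0.
Proof.
move=> xo; have := mulA111 x x x.
rewrite xo shift_mul21 shift_mul12 mul21_d mul12_d xo.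
rewrite !shift_d // !shiftD (sdc_dd (i := 1) (j := 2)) // => /shift_inj e.
rewrite diffV2E; apply/eqP; rewrite subr_eq0; apply/eqP.
by rewrite addrAC [X in X - _]addrC -e addrAC subrr add0r.
Qed.

(** Multiplying by [g] changes the vector [o] through the residue of [g] only,
    which is [1]. *)
Lemma mc_defect_gauge (g : E 0 A) x x' o :
  mul01 g x = mul10 x' g -> mc_defect x o -> mc_defect x' o.
Proof.
move=> gx xo; apply: (@mul20_inj _ _ _ E A g).
rewrite mulA110 -gx -mulA101 -gx mulA011 xo shift_mul02 shift_mul20.
by rewrite mul02_d mul20_d gx.
Qed.

(** The failure of a lift [g] of an isomorphism over [B] to conjugate [w] to
    [w']. *)
Definition iso_defect (w w' : E 1 A) (g : E 0 A) (o : C 1 V) : Prop :=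
  mul01 g w = sh 1 (mul10 w' g) o.

Lemma iso_defect_ex w w' g :
  conjugates (fmap (E 0) f g) (fmap (E 1) f w) (fmap (E 1) f w') ->
  exists o, iso_defect w w' g o.
Proof.
move=> /conjugatesP e; apply: (shift_ex fr (hE 1)).
by rewrite fmap_mul01 fmap_mul10 e.
Qed.

Lemma iso_defect0 w w' g : iso_defect w w' g 0 <-> conjugates g w w'.
Proof. by rewrite conjugatesP /iso_defect shift0. Qed.

Lemma iso_defect_shift w w' g o v :
  iso_defect w w' g o -> iso_defect w w' (sh 0 g v) (o - diffV v).
Proof.
rewrite /iso_defect shift_mul01l shift_mul10r => ->; rewrite !shiftD.
by congr (sh 1 _ _); rewrite diffV0E opprB [RHS]addrCA [X in _ = _ + X]addrC subrK.
Qed.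

(** The conjugate of [w] by [g] satisfies the Maurer-Cartan equation and is
    [w'] shifted by the defect of [g]. *)
Lemma iso_defect_cocycle w w' g o : is_mc w -> is_mc w' ->
  iso_defect w w' g o -> diffV o = 0.
Proof.
move=> mcw mcw' gw; have [h [gh hg]] := E0_inverse g.
have e : mul10 (mul01 g w) h = sh 1 w' o by rewrite gw shift_mul10l mulA100 gh mulr1_10.
have def : mc_defect (sh 1 w' o) (diffV o).
  by rewrite -[diffV o]add0r; apply/mc_defect_shift/mc_defect0.
apply: (mc_defect_uniq def); rewrite -e; apply: (@mc_defect_gauge g w); last exact/mc_defect0.
by rewrite mulA100 hg mulr1_10.
Qed.
End Extension.

Section Naturality.
Variables (A B : art pi) (f : hom A B) (V : vectType k) (j : {additive V -> A}).
Variables (A' B' : art pi) (f' : hom A' B') (V' : vectType k) (j' : {additive V' -> A'}).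
Hypotheses (fr : is_framed f j) (fr' : is_framed f' j').
Variables (g : hom A A') (u : {linear V -> V'}).
Hypothesis gj : forall v, g (j v) = j' (u v).

Lemma mc_defect_fmap x o :
  mc_defect fr x o -> mc_defect fr' (fmap (E 1) g x) (lact u o).
Proof.
rewrite /mc_defect -fmap_mul11 => ->.
by rewrite (shift_fmap (hF := hE 2) fr fr' gj) sdc_d_nat.
Qed.

Lemma iso_defect_fmap w w' x o : iso_defect fr w w' x o ->
  iso_defect fr' (fmap (E 1) g w) (fmap (E 1) g w') (fmap (E 0) g x) (lact u o).
Proof.
rewrite /iso_defect -fmap_mul01 => ->.
by rewrite (shift_fmap (hF := hE 1) fr fr' gj) fmap_mul10.
Qed.
End Naturality.

End Obstruction.

(** * Tensor products with a finite-dimensional space *)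

Section TensorContraction.
Variables (k : fieldType) (V : lmodType k).

Section Rel.
Variable J : lmodType k.
Local Notation rel := (@tensor_rel k V J).

Lemma tensor_piP s t : \pi_(tensor V J) s = \pi_(tensor V J) t <-> rel s t.
Proof.
split=> [/eqP|h]; first by rewrite eqmodE => /asboolP.
by apply/eqP; rewrite eqmodE; apply/asboolP.
Qed.

Definition contract_seq (l : {linear J -> k^o}) (s : seq (V * J)) : V :=
  \sum_(x <- s) (l x.2 : k) *: x.1.

Lemma contract_seq_rel l s t : rel s t -> contract_seq l s = contract_seq l t.
Proof.
rewrite /contract_seq; elim=> {s t} //.
- by move=> s t u _ -> _ ->.
- by move=> s s' t t' _ e _ e'; rewrite !big_cat /= e e'.
- by move=> s t; rewrite !big_cat /= addrC.
- by move=> j; rewrite big_seq1 big_nil scaler0.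
- by move=> v v' j; rewrite !big_cons !big_nil !addr0 /= scalerDr.
- by move=> v j j'; rewrite !big_cons !big_nil !addr0 /= linearD scalerDl.
- move=> a v j; rewrite !big_seq1 /=.
  have -> : l (a *: j) = (a * (l j : k) : k) by rewrite linearZ.
  by rewrite mulrC scalerA.
Qed.

Definition contract (l : {linear J -> k^o}) (t : tensor V J) : V :=
  contract_seq l (repr t).

Lemma contract_pi l s : contract l (\pi s) = contract_seq l s.
Proof. by apply: contract_seq_rel; apply/tensor_piP; rewrite reprK. Qed.

Lemma rel_merge (T : Type) (r : seq T) (a b : T -> V) (e : T -> J) :
  rel ([seq (a i, e i) | i <- r] ++ [seq (b i, e i) | i <- r])
      [seq (a i + b i, e i) | i <- r].
Proof.
elim: r => [|i r IH] /=; first exact: tensor_refl.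
set s := map _ _ in IH *; set t := map _ _ in IH *; set u := map _ _ in IH *.
apply: tensor_trans (_ : rel ([:: (a i, e i); (b i, e i)] ++ (s ++ t)) _).
  apply: (@tensor_cat _ _ _ [:: (a i, e i)] [:: (a i, e i)]).
    exact: tensor_refl.
  rewrite -cat1s catA -[X in rel _ X]cat1s [X in rel _ X]catA.
  by apply: tensor_cat; [exact: tensor_comm|exact: tensor_refl].
rewrite -[X in rel _ X]cat1s; apply: tensor_cat => //.
exact/tensor_sym/tensor_addl.
Qed.

Lemma rel_zero (T : Type) (r : seq T) (e : T -> J) : rel [seq (0, e i) | i <- r] [::].
Proof.
elim: r => [|i r IH] /=; first exact: tensor_refl.
rewrite -[X in rel _ X]cats0 -cat1s; apply: tensor_cat => //; exact: tensor_zero.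
Qed.

Lemma rel_sumr (T : Type) (r : seq T) (v : V) (y : T -> J) :
  rel [:: (v, \sum_(i <- r) y i)] [seq (v, y i) | i <- r].
Proof.
elim: r => [|i r IH] /=.
  have h := tensor_scale 0 v (0 : J); rewrite !scale0r in h.
  by rewrite big_nil; apply: tensor_trans (tensor_sym h) (tensor_zero _ _).
rewrite big_cons; apply: tensor_trans (tensor_addr _ _ _) _.
by rewrite -cat1s -[X in rel _ X]cat1s; apply: tensor_cat => //; exact: tensor_refl.
Qed.

Lemma rel_map (T : eqType) (r : seq T) (F G : T -> V * J) :
  (forall i, rel [:: F i] [:: G i]) -> rel (map F r) (map G r).
Proof.
move=> FG; elim: r => [|i r IH]; first exact: tensor_refl.
by rewrite /= -cat1s -[X in rel _ X]cat1s; apply: tensor_cat.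
Qed.

Section Frame.
Variables (n : nat) (phi : {linear 'rV[k]_n -> J}) (psi : {linear J -> 'rV[k]_n}).
Hypothesis psiK : cancel psi phi.

(** Modulo the relations, every formal sum has a normal form supported on a
    basis of [J], with coefficients its contractions with the dual basis. *)
Lemma rel_frame s : rel s
  [seq (contract_seq (@rcoord k n i \o psi) s, phi (delta_mx 0 i)) | i <- enum 'I_n].
Proof.
elim: s => [|[v y] s IH].
  rewrite /contract_seq; under eq_map do rewrite big_nil.
  exact/tensor_sym/rel_zero.
rewrite /contract_seq; under eq_map do rewrite big_cons.
apply: tensor_trans (rel_merge _ _ _ _).
rewrite -cat1s; apply: tensor_cat => //.
have yE : y = \sum_(i <- enum 'I_n) psi y 0 i *: phi (delta_mx 0 i).
  rewrite -{1}(psiK y) {1}(row_sum_delta (psi y)) linear_sum big_enum.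
  by apply: eq_bigr => i _; rewrite linearZ.
apply: tensor_trans (_ : rel _ [seq (v, psi y 0 i *: phi (delta_mx 0 i)) | i <- enum 'I_n]) _.
  by rewrite {1}yE; exact: rel_sumr.
by apply: rel_map => i; exact/tensor_sym/tensor_scale.
Qed.

Lemma tensor_ext (t t' : tensor V J) :
  (forall l, contract l t = contract l t') -> t = t'.
Proof.
move=> tt'; rewrite -[t]reprK -[t']reprK; apply/tensor_piP.
apply: tensor_trans (rel_frame _) _; apply: tensor_trans (tensor_sym (rel_frame _)).
by rewrite (eq_map (g := fun i => (contract (@rcoord k n i \o psi) t', phi (delta_mx 0 i)))
  (fun i => congr1 (pair^~ _) (tt' _))); exact: tensor_refl.
Qed.
End Frame.

Lemma contract_tensor0 l : contract l (tensor0 V J) = 0.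
Proof. by rewrite contract_pi /contract_seq big_nil. Qed.
End Rel.

Lemma contract_map (J J' : lmodType k) (u : {linear J -> J'}) l (t : tensor V J) :
  contract l (tensor_map u t) = contract (l \o u) t.
Proof. by rewrite contract_pi /contract_seq big_map. Qed.

End TensorContraction.

(** * From cocycles to complete obstruction spaces *)

Section SmallExtensionFrames.
Variables (R : comNzRingType) (k : fieldType) (pi : {rmorphism R -> k}).

(** The coordinates on the kernel provided by [exists_framed] are linear for
    the given vector space structure of [se_ker e], because both structures
    are induced by multiplication in the source ring. *)
Lemma small_ext_frame_ex (e : small_ext pi) :
  exists p : {n : nat & ({linear 'rV[k]_n -> se_ker e} * {linear se_ker e -> 'rV[k]_n})%type},
    [/\ cancel (projT2 p).1 (projT2 p).2, cancel (projT2 p).2 (projT2 p).1 &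
        is_framed (se_hom e) (se_inc e \o (projT2 p).1)].
Proof.
have [|n [j fr]] := @exists_framed _ _ _ _ _ (se_hom e) (@se_surj _ _ _ e).
  move=> a x ma /se_exact [y ->]; rewrite se_scale.
  by rewrite (ma : art_res _ a = 0) scale0r raddf0.
have jZ a v : exists x, art_res (se_src e) x = a /\ j (a *: v) = x * j v.
  by have [x <-] := art_res_surj (se_src e) a; exists x; rewrite (fr_scale fr).
have incZ x y : se_inc e (art_res (se_src e) x *: y) = x * se_inc e y by rewrite se_scale.
have phi_ex v : {y | se_inc e y = j v}.
  apply: cid; have /se_exact [y hy] := framed_ker0 v fr; by exists y.
have psi_ex y : {v | j v = se_inc e y}.
  apply: cid; have /(fr_ker fr) [v hv] : se_hom e (se_inc e y) = 0.
    by apply/se_exact; exists y.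
  by exists v.
pose phi v := sval (phi_ex v); pose psi y := sval (psi_ex y).
have phiE v : se_inc e (phi v) = j v by apply: (svalP (phi_ex v)).
have psiE y : j (psi y) = se_inc e y by apply: (svalP (psi_ex y)).
have phiL : linear phi.
  move=> a u v; apply: (@se_inc_inj _ _ _ e); rewrite raddfD !phiE raddfD.
  by have [x [xa ->]] := jZ a u; rewrite -xa incZ phiE.
have psiL : linear psi.
  move=> a y z; apply: (fr_inj fr); rewrite raddfD !psiE raddfD.
  by have [x [xa ->]] := jZ a (psi y); rewrite psiE -xa incZ.
pose Phi : {linear 'rV[k]_n -> se_ker e} := HB.pack phi (GRing.isLinear.Build _ _ _ _ phi phiL).
pose Psi : {linear se_ker e -> 'rV[k]_n} := HB.pack psi (GRing.isLinear.Build _ _ _ _ psi psiL).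
exists (existT _ n (Phi, Psi)); split=> /=.
- by move=> v; apply: (fr_inj fr); rewrite /= psiE phiE.
- by move=> y; apply: (@se_inc_inj _ _ _ e); rewrite /= phiE psiE.
split=> [|u v /=|x|x v].
- exact: fr_surj fr.
- by rewrite !phiE; exact: (fr_inj fr).
- rewrite (fr_ker fr); split=> -[v ->]; exists v; by rewrite /= phiE.
- by rewrite /= !phiE (fr_scale fr).
Qed.

Variable e : small_ext pi.
Definition frame_dim : nat := projT1 (sval (cid (small_ext_frame_ex e))).
Definition frame : {linear 'rV[k]_frame_dim -> se_ker e} :=
  (projT2 (sval (cid (small_ext_frame_ex e)))).1.
Definition coframe : {linear se_ker e -> 'rV[k]_frame_dim} :=
  (projT2 (sval (cid (small_ext_frame_ex e)))).2.
Lemma frameK : cancel frame coframe.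
Proof. by have [] := svalP (cid (small_ext_frame_ex e)). Qed.
Lemma coframeK : cancel coframe frame.
Proof. by have [] := svalP (cid (small_ext_frame_ex e)). Qed.
Lemma framed_frame : is_framed (se_hom e) (se_inc e \o frame).
Proof. by have [] := svalP (cid (small_ext_frame_ex e)). Qed.
End SmallExtensionFrames.

Section CohomologyClasses.
Variables (R : comNzRingType) (k : fieldType) (pi : {rmorphism R -> k}).
Variable E : sdc pi.
Local Notation hE := (sdc_homogeneous E).
Local Notation C n := (tsp (homogeneous_pointwise (hE n))).

(** The class of [z], meaningful when [z] is a cocycle. *)
Definition coclass n (z : cochain E n) : cohomology E n :=
  cohomology_class (insubd (0 : cocycle E n) z).

Lemma insubd_cocycle n (z : cochain E n) :
  diff z = 0 -> cocycle_val (insubd (0 : cocycle E n) z) = z.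
Proof. by move=> dz; apply: (insubdK (0 : cocycle E n)); rewrite inE dz. Qed.

Lemma cocycle_val_inj n : injective (@cocycle_val _ _ _ E n).
Proof. exact: val_inj. Qed.

Lemma coclass_linear n a (z z' : cochain E n) : diff z = 0 -> diff z' = 0 ->
  coclass (a *: z + z') = a *: coclass z + coclass z'.
Proof.
move=> dz dz'; have dzz' : diff (a *: z + z') = 0 by rewrite linearP /= dz dz' scaler0 addr0.
rewrite [a *: coclass z](cohomology_scale_class a (insubd (0 : cocycle E n) z)).
rewrite -[RHS]cohomology_classD; congr cohomology_class; apply: cocycle_val_inj.
by rewrite [RHS]cocycle_valP !insubd_cocycle.
Qed.

Lemma coclassP n (z z' : cochain E n) : diff z = 0 -> diff z' = 0 ->
  coclass z = coclass z' <-> is_coboundary (z - z').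
Proof.
move=> dz dz'; rewrite /coclass cohomology_classP.
set x := insubd _ z; set y := insubd _ z'.
have -> : x - y = -1 *: y + x by rewrite scaleN1r addrC.
by rewrite cocycle_valP !insubd_cocycle // scaleN1r addrC.
Qed.

Lemma coclass0 n : coclass (0 : cochain E n) = 0.
Proof.
have d0 : diff (0 : cochain E n) = 0 by rewrite linear0.
have := coclass_linear 1 d0 d0; rewrite scaler0 addr0 scale1r => h.
by apply: (addrI (coclass (0 : cochain E n))); rewrite addr0 -h.
Qed.

Lemma coclass_surj n (c : cohomology E n) : exists2 z : cochain E n, diff z = 0 & coclass z = c.
Proof.
have [[z hz] <-] := cohomology_class_surj c; exists z; first by apply/eqP.
congr cohomology_class; apply: cocycle_val_inj; rewrite /= insubd_cocycle //; exact/eqP.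
Qed.

Lemma coclass_sum n m (a : 'I_m -> k) (z : 'I_m -> cochain E n) :
  (forall i, diff (z i) = 0) ->
  coclass (\sum_i a i *: z i) = \sum_i a i *: coclass (z i).
Proof.
move=> dz; suff [_ ->] : diff (\sum_i a i *: z i) = 0 /\
    coclass (\sum_i a i *: z i) = \sum_i a i *: coclass (z i) by [].
apply: (big_rec2 (fun s c => diff s = 0 /\ coclass s = c)) => [|i c s _ [ds <-]].
  by rewrite linear0 coclass0.
by rewrite linearP /= dz ds scaler0 addr0 coclass_linear.
Qed.

Lemma coclass_eq0 n (z : cochain E n) : diff z = 0 -> coclass z = 0 <-> is_coboundary z.
Proof. by move=> dz; have := coclassP dz (linear0 (@diff _ _ _ E n)); rewrite subr0 coclass0. Qed.

(** The tensor of a cocycle with coefficients in [J] is characterised by its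
    contractions, hence independent of the basis. *)
Lemma coclass_tensor (J : lmodType k) n m (phi : {linear 'rV[k]_m -> J}) (o : C n 'rV[k]_m) :
  diffV o = 0 -> exists t : tensor (cohomology E n) J,
    forall l : {linear J -> k^o}, contract l t = coclass (lact (l \o phi) o).
Proof.
move=> do0; have dl i : diff (lact (rcoord i) o : cochain E n) = 0.
  by rewrite -diffVE -lact_diffV do0 lact0.
exists (\pi_(tensor _ _)
  [seq (coclass (lact (rcoord i) o), phi (delta_mx 0 i)) | i <- enum 'I_m]) => l.
rewrite contract_pi /contract_seq big_map big_enum /=.
rewrite (lact_coord (l \o phi) o); symmetry; exact: coclass_sum.
Qed.

Lemma coboundary_of_classes n m (o : C n.+1 'rV[k]_m) : diffV o = 0 ->
  (forall l : {linear 'rV[k]_m -> k^o}, coclass (lact l o) = 0) ->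
  exists v : C n 'rV[k]_m, o = diffV v.
Proof.
move=> do0 cl0.
have dl (l : {linear 'rV[k]_m -> k^o}) : diff (lact l o : cochain E n.+1) = 0.
  by rewrite -diffVE -lact_diffV do0 lact0.
have bd i : {y : cochain E n | lact (rcoord i) o = diff y}.
  by apply: cid; have /coclass_eq0 := cl0 (rcoord i); apply.
have [v hv] := lact_assemble (hF := homogeneous_pointwise (hE n)) (fun i => sval (bd i)).
exists v; apply: lact_separate => l; rewrite !(lact_coord l).
apply: eq_bigr => i _; rewrite lact_diffV hv.
exact: (congr1 (fun z : C n.+1 k^o => (l (delta_mx 0 i) : k) *: z) (svalP (bd i))).
Qed.

Lemma coclass_boundary n m (l : {linear 'rV[k]_m -> k^o}) (o : C n.+1 'rV[k]_m) (v : C n 'rV[k]_m) :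
  diffV o = 0 -> diffV (o + diffV v) = 0 ->
  coclass (lact l (o + diffV v)) = coclass (lact l o).
Proof.
have d0 (z : C n.+1 'rV[k]_m) : diffV z = 0 -> diff (lact l z : cochain E n.+1) = 0.
  by move=> dz; rewrite -diffVE -lact_diffV dz lact0.
move=> /d0 h /d0 h'; apply/coclassP => //; exists (lact l v).
by rewrite -diffVE -lact_diffV lactD addrC addKr.
Qed.

End CohomologyClasses.

Section ObstructionSpace.
Variables (R R' : comNzRingType) (k : fieldType).
Variables (pi : {rmorphism R -> k}) (pi' : {rmorphism R' -> k}).
Variables (E : sdc pi) (F : functor pi') (n : nat).
Local Notation C n := (tsp (homogeneous_pointwise (sdc_homogeneous E n))).

(** If the failure of [x] to lift along [e] is measured by a cocycle [o] with
    coefficients in the kernel of [e], well defined up to coboundaries, then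
    its class is an obstruction. *)
Lemma obstruction_space_of_cocycles
    (def : forall e : small_ext pi', F (se_tgt e) -> C n.+1 'rV[k]_(frame_dim e) -> Prop) :
  (forall e x o, def e x o -> diffV o = 0) ->
  (forall e x, exists o, def e x o) ->
  (forall e x o o', def e x o -> def e x o' -> exists v, o' = o + diffV v) ->
  (forall e e' (a : small_ext_mor e e') x o, def e x o ->
    def e' (fmap F (sem_tgt a) x) (lact (coframe e' \o sem_ker a \o frame e) o)) ->
  (forall e x, lifts x -> def e x 0) ->
  (forall e x v, def e x (diffV v) -> lifts x) ->
  complete_obstruction_space F (cohomology E n.+1).
Proof.
move=> def_cocycle def_ex def_uniq def_nat lift_def def_lift.
have ob_ex e x : {t : tensor (cohomology E n.+1) (se_ker e) |
    forall o, def e x o -> forall l, contract l t = coclass (lact (l \o frame e) o)}.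
  apply: cid; have [o xo] := def_ex e x.
  have [t ht] := coclass_tensor (frame e) (def_cocycle _ _ _ xo).
  exists t => o' xo' l; have [v ev] := def_uniq _ _ _ _ xo xo'.
  have do' := def_cocycle _ _ _ xo'; rewrite ht; rewrite ev in do' *.
  by rewrite coclass_boundary //; exact: def_cocycle xo.
pose ob e (x : F (se_tgt e)) := sval (ob_ex e x).
have obE e x o : def e x o ->
    forall l, contract l (ob e x) = coclass (lact (l \o frame e) o).
  exact: (svalP (ob_ex e x)).
have ob_lift e (x : F (se_tgt e)) : lifts x -> ob e x = tensor0 _ (se_ker e).
  move=> /lift_def xo; apply: (tensor_ext (@coframeK _ _ _ e)) => l.
  rewrite (obE _ _ _ xo) contract_tensor0 -[RHS]coclass0; congr coclass.
  exact: lact0.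
have obN e e' (a : small_ext_mor e e') (x : F (se_tgt e)) :
    tensor_map (sem_ker a) (ob e x) = ob e' (fmap F (sem_tgt a) x).
  have [o xo] := def_ex e x; apply: (tensor_ext (@coframeK _ _ _ e')) => l.
  rewrite contract_map (obE _ _ _ xo) (obE _ _ _ (def_nat _ _ a _ _ xo)) lact_comp.
  by congr coclass; apply: lact_ext => v; rewrite /= coframeK.
exists (ObstructionTheory ob_lift obN) => e x /= ob0.
have [o xo] := def_ex e x.
have [|v ov] := coboundary_of_classes (def_cocycle _ _ _ xo).
  move=> l; have := obE _ _ _ xo (l \o coframe e).
  rewrite ob0 contract_tensor0 => h; rewrite h; congr coclass.
  by apply: lact_ext => v; rewrite /= frameK.
by apply: (def_lift e x v); rewrite -ov.
Qed.
End ObstructionSpace.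

(** * Deformations *)

Lemma inj_surj_bijective (S T : Type) (f : S -> T) :
  injective f -> (forall y, exists x, f x = y) -> bijective f.
Proof.
move=> fI fS; exists (fun y => sval (cid (fS y))) => [x|y].
  exact: fI (svalP (cid (fS (f x)))).
exact: (svalP (cid (fS y))).
Qed.

Section DefFunctor.
Variables (R : comNzRingType) (k : fieldType) (pi : {rmorphism R -> k}).
Variable E : sdc pi.
Implicit Types A B : art pi.
Local Notation hE := (sdc_homogeneous E).
Local Notation C n := (tsp (homogeneous_pointwise (hE n))).

Lemma gauge_equivP A (w w' : mc E A) :
  gauge_equiv w w' <-> exists g, mul01 g (sval w) = mul10 (sval w') g.
Proof. by split=> -[g /conjugatesP hg]; exists g. Qed.

Section Glue.
Variables (A B C P : art pi) (f : hom B A) (g : hom C A) (p : hom P B) (q : hom P C).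
Hypotheses (fp : is_fibre_product f g p q) (fS : hsurj f).

Lemma mc_glue (w : mc E B) (w' : mc E C) :
  fmap (E 1) f (sval w) = fmap (E 1) g (sval w') ->
  exists t : mc E P, mc_map p t = w /\ mc_map q t = w'.
Proof.
have [eS _] := hE 1 fp fS; have [_ eI] := hE 2 fp fS.
move=> /eS [t [pt qt]].
have mct : is_mc t.
  apply: eI; rewrite fmap_mul11 sdc_d_nat // ?pt ?qt; last exact: (svalP w').
  exact: (svalP w).
by exists (exist _ t mct); split; apply: mc_eq.
Qed.

Lemma intertwiner_glue (w w' : E 1 P) (b : E 0 B) (c : E 0 C) :
  fmap (E 0) f b = fmap (E 0) g c ->
  mul01 b (fmap (E 1) p w) = mul10 (fmap (E 1) p w') b ->
  mul01 c (fmap (E 1) q w) = mul10 (fmap (E 1) q w') c ->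
  exists t, [/\ fmap (E 0) p t = b, fmap (E 0) q t = c & mul01 t w = mul10 w' t].
Proof.
have [eS _] := hE 0 fp fS; have [_ eI] := hE 1 fp fS.
move=> /eS [t [<- <-]] hp hq; exists t; split=> //.
by apply: eI; rewrite fmap_mul01 fmap_mul10.
Qed.

(** A gauge transformation between the restrictions lifts along [B -> A], and
    moves one of the two elements until they agree on the nose. *)
Lemma def_eta_surjective : eta_surjective (def_functor E) f g p q.
Proof.
move=> b c /=; have [w <-] := def_class_surj b; have [w' <-] := def_class_surj c.
rewrite !def_map_class => /def_classP /gauge_equivP [a0 ha].
have [a fa] := @sdc_smooth _ _ _ E 0 _ _ f fS a0.
have [a' [aa' a'a]] := E0_inverse a.
pose x := mul10 (mul01 a (sval w)) a'.
have ax : mul01 a (sval w) = mul10 x a by rewrite mulA100 a'a mulr1_10.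
have mcx : is_mc x.
  have fr0 : mul20 (mul11 x x) a = mul20 (sdc_d 1 x) a.
    by rewrite mulA110 -ax -mulA101 -ax mulA011 (svalP w) mul02_d mul20_d ax.
  exact: mul20_inj fr0.
have fx : fmap (E 1) f x = fmap (E 1) g (sval w').
  by rewrite fmap_mul10 fmap_mul01 fa ha mulA100 -fa -fmap_mul00 aa' sdc_one_nat mulr1_10.
have [t [pt qt]] := @mc_glue (exist _ x mcx) w' fx.
exists (def_class t); rewrite !def_map_class pt qt; split=> //.
apply/def_classP/gauge_equivP; exists a' => /=.
by rewrite /x -mulA010 -mulA001 a'a mul1_01.
Qed.
End Glue.

Lemma def_deformation_functor : deformation_functor (def_functor E).
Proof.
split=> [A B C P f g p q fp fS|B C P f g p q fp fS].
  exact: def_eta_surjective fp fS.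
split; first exact: def_eta_surjective fp fS.
move=> b c /=; have [w <-] := def_class_surj b; have [w' <-] := def_class_surj c.
rewrite !def_map_class => /def_classP /gauge_equivP [b' hb] /def_classP /gauge_equivP [c' hc].
apply/def_classP/gauge_equivP.
have [|t [_ _ ht]] := intertwiner_glue fp fS _ hb hc; last by exists t.
by rewrite [LHS]fpt_uniq [RHS]fpt_uniq.
Qed.

Lemma cocycle0_eq0 : (forall x : cohomology E 0, x = 0) ->
  forall n (v : C 0 'rV[k]_n), diffV v = 0 -> v = 0.
Proof.
move=> H0 n v dv; apply: lact_separate => l.
rewrite lact0; have dl : diff (lact l v : cochain E 0) = 0.
  by rewrite -diffVE -lact_diffV dv lact0.
by have /(coclass_eq0 dl) := H0 (coclass (lact l v : cochain E 0)).
Qed.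

(** Two intertwiners that agree over [B] differ over [A] by a cocycle in
    degree zero. *)
Lemma intertwiner_uniq : (forall x : cohomology E 0, x = 0) ->
  forall A (w w' : E 1 A) (g g' : E 0 A),
  mul01 g w = mul10 w' g -> mul01 g' w = mul10 w' g' -> g = g'.
Proof.
move=> H0; elim/art_ind => [|A B f n j fr IH] w w' g g' hg hg'.
  by rewrite [LHS]fpt_uniq [RHS]fpt_uniq.
have : fmap (E 0) f g = fmap (E 0) f g'.
  apply: (IH (fmap (E 1) f w) (fmap (E 1) f w')); rewrite -fmap_mul01 -fmap_mul10.
    by rewrite hg.
  by rewrite hg'.
move=> /(shift_ex fr (hE 0)) [v ev].
have d0 : iso_defect fr w w' g 0 by apply/iso_defect0/conjugatesP.
have d1 : iso_defect fr w w' g' 0 by apply/iso_defect0/conjugatesP.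
have := iso_defect_shift v d0; rewrite -ev sub0r => d2.
have dv : diffV v = 0.
  apply: oppr_inj; rewrite oppr0; apply: (shift_inj (fr := fr) (x := mul10 w' g')).
  by rewrite -d2 -d1.
by rewrite ev (cocycle0_eq0 H0 dv) shift0.
Qed.

(** The gauge transformations over [B] and [C] have the same image over [A] by
    uniqueness of intertwiners, so they glue. *)
Lemma def_homogeneous : (forall x : cohomology E 0, x = 0) -> homogeneous (def_functor E).
Proof.
move=> H0 A B C P f g p q fp fS; split; first exact: def_eta_surjective fp fS.
move=> b c /=; have [w <-] := def_class_surj b; have [w' <-] := def_class_surj c.
rewrite !def_map_class => /def_classP /gauge_equivP [b' hb] /def_classP /gauge_equivP [c' hc].
apply/def_classP/gauge_equivP.
have [|t [_ _ ht]] := intertwiner_glue fp fS _ hb hc; last by exists t.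
have e (v : E 1 P) : fmap (E 1) f (fmap (E 1) p v) = fmap (E 1) g (fmap (E 1) q v).
  by rewrite -!fmap_comp; apply: fmap_ext => y; have [h _] := fp; exact: h.
apply: (intertwiner_uniq H0 (w := fmap (E 1) f (fmap (E 1) p (sval w)))
  (w' := fmap (E 1) f (fmap (E 1) p (sval w')))).
  by rewrite -fmap_mul01 -fmap_mul10 [mul01 _ _]hb.
by rewrite !e -fmap_mul01 -fmap_mul10 [mul01 _ _]hc.
Qed.

(** Over [k + V] the Maurer-Cartan equation and the gauge action are linear. *)
Lemma mc_sqzP (V : vectType k) (v : C 1 V) : is_mc (v : E 1 (sqzobj pi V)) <-> diffV v = 0.
Proof.
rewrite /is_mc mul11_split diffV1E addrAC [X in X - _ = _]addrC.
by split=> [->|/eqP]; rewrite ?subrr // subr_eq0 => /eqP.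
Qed.

Lemma gauge_sqzP (V : vectType k) (g : C 0 V) (v v' : C 1 V) :
  mul01 g v = mul10 v' g <-> v - v' = diffV g.
Proof.
have swap (Z : zmodType) (a b x y : Z) : (a + x = y + b) <-> (x - y = b - a).
  have eab : a + (b - a + y) = y + b by rewrite addrA [a + _]addrC subrK addrC.
  split=> [e|/eqP]; last by rewrite subr_eq => /eqP ->.
  by apply/eqP; rewrite subr_eq -(inj_eq (addrI a)) e eab.
rewrite mul01_split mul10_split diffV0E; exact: (swap (C 1 V)).
Qed.


Lemma def_tangent (h : pointwise_homogeneous (def_functor E)) :
  linear_iso (tangent h) (cohomology E 1).
Proof.
pose f (c : tangent h) : cohomology E 1 :=
  coclass (sval (repr (c : {eq_quot (@gauge_rel _ _ _ E (dual pi))})) : cochain E 1).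
have dmc (w : mc E (dual pi)) : diff (sval w : cochain E 1) = 0.
  by rewrite -diffVE; apply/mc_sqzP; exact: (svalP w).
have fE (w w' : mc E (dual pi)) : def_class w = def_class w' <->
    coclass (sval w : cochain E 1) = coclass (sval w' : cochain E 1).
  rewrite def_classP gauge_equivP coclassP //; split=> -[g hg]; exists g.
    exact/gauge_sqzP.
  exact/gauge_sqzP.
have fclass w : f (def_class w) = coclass (sval w : cochain E 1).
  by apply/fE; exact: reprK.
have fL : linear f.
  move=> a x y; pose t := tpair h x y.
  have [w tw] := def_class_surj (t : def_obj E _).
  have act (u : {linear (k^o * k^o)%type -> k^o}) :
      lact u t = def_class (mc_map (hsqz pi u) w) by rewrite -tw; exact: def_map_class.
  have -> : x = lact fst t by rewrite tpair1.
  have -> : y = lact snd t by rewrite tpair2.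
  have -> : a *: (lact fst t : tangent h) + lact snd t =
      lact (a \*: fst \+ snd : {linear (k^o * k^o)%type -> k^o}) t.
    change (tadd (hF := h) (tscale (hF := h) a (lact fst t)) (lact snd t) =
      lact (a \*: fst \+ snd : {linear (k^o * k^o)%type -> k^o}) t).
    by rewrite lact_scale lact_add.
  rewrite !act !fclass -coclass_linear //; congr coclass.
  rewrite [LHS](@lact_addr _ _ _ _ (homogeneous_pointwise (hE 1)) _ _ (a \*: fst) snd (sval w)).
  by congr (_ + _); rewrite -[RHS]/(tsp_scale (hF := homogeneous_pointwise (hE 1)) a _) tsp_scaleE.
pose fM : {linear tangent h -> cohomology E 1} := HB.pack f (GRing.isLinear.Build _ _ _ _ f fL).
exists fM; apply: inj_surj_bijective => [c d|y].
  have [w <-] := def_class_surj (c : def_obj E _).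
  have [w' <-] := def_class_surj (d : def_obj E _).
  by rewrite /= !fclass => /fE.
have [z dz <-] := coclass_surj y.
have mcz : is_mc (z : E 1 (dual pi)) by apply/mc_sqzP.
by exists (def_class (exist _ z mcz)); rewrite /= fclass.
Qed.

Lemma def_obstruction_space : complete_obstruction_space (def_functor E) (cohomology E 2).
Proof.
pose def (e : small_ext pi) (c : def_functor E (se_tgt e)) (o : C 2 'rV[k]_(frame_dim e)) :=
  exists (x : E 1 (se_src e)) (w : mc E (se_tgt e)),
  [/\ c = def_class w, fmap (E 1) (se_hom e) x = sval w & mc_defect (framed_frame e) x o].
apply: (@obstruction_space_of_cocycles _ _ _ _ _ E _ 1 def).
- by move=> e c o [x [w [_ _ /mc_defect_cocycle]]].
- move=> e c; have [w <-] := def_class_surj c.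
  have [x xw] := @sdc_smooth _ _ _ E 1 _ _ (se_hom e) (@se_surj _ _ _ e) (sval w).
  have [|o xo] := @mc_defect_ex _ _ _ E _ _ _ _ _ (framed_frame e) x.
    by rewrite xw; exact: (svalP w).
  by exists o, x, w.
- move=> e _ o o' [x [w [-> xw xo]]] [x' [w' [ww' xw' xo']]].
  move/def_classP/gauge_equivP: ww' => [a0 ha].
  have [a fa] := @sdc_smooth _ _ _ E 0 _ _ (se_hom e) (@se_surj _ _ _ e) a0.
  have [a' [aa' a'a]] := E0_inverse a.
  pose y := mul10 (mul01 a x) a'.
  have ay : mul01 a x = mul10 y a by rewrite mulA100 a'a mulr1_10.
  have yo := mc_defect_gauge ay xo.
  have : fmap (E 1) (se_hom e) y = fmap (E 1) (se_hom e) x'.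
    rewrite fmap_mul10 fmap_mul01 fa xw ha xw' mulA100 -fa -fmap_mul00 aa'.
    by rewrite sdc_one_nat mulr1_10.
  move=> /(shift_ex (framed_frame e) (hE 1)) [v ev].
  exists v; apply: mc_defect_uniq xo' _; rewrite ev; exact: mc_defect_shift.
- move=> e e' a _ o [x [w [-> xw xo]]].
  exists (fmap (E 1) (sem_src a) x), (mc_map (sem_tgt a) w); split.
  + exact: def_map_class.
  + by rewrite /= -xw -!fmap_comp; apply: fmap_ext => y; rewrite /= sem_comm_hom.
  + by apply: mc_defect_fmap xo => v; rewrite /= coframeK sem_comm_inc.
- move=> e c [c' <-]; have [w <-] := def_class_surj c'.
  exists (sval w), (mc_map (se_hom e) w); split=> //; first exact: def_map_class.
  by apply/mc_defect0; exact: (svalP w).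
- move=> e c v [x [w [-> xw xo]]].
  have := mc_defect_shift (- v) xo.
  rewrite linearN /= subrr => /mc_defect0 mcy.
  exists (def_class (exist _ _ mcy)); rewrite [LHS]def_map_class; congr def_class.
  by apply: mc_eq; rewrite /= fmap_shift.
Qed.
End DefFunctor.

(** * Isomorphisms *)

Section IsoFunctor.
Variables (R : comNzRingType) (k : fieldType) (pi : {rmorphism R -> k}).
Variables (E : sdc pi) (A : art pi) (w w' : mc E A).
Local Notation hE := (sdc_homogeneous E).
Local Notation C n := (tsp (homogeneous_pointwise (hE n))).

Local Notation wat B := (fmap (E 1) (hstr B) (sval w)).
Local Notation wat' B := (fmap (E 1) (hstr B) (sval w')).

Lemma fmap_hstr B D (f : hom B D) (x : E 1 A) :
  fmap (E 1) (hrestr f) (fmap (E 1) (hstr B) x) = fmap (E 1) (hstr D) x.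
Proof. by rewrite -fmap_comp; apply: fmap_ext; exact: hstr_comp. Qed.

Lemma iso_objP B (g : E 0 (restr B)) :
  is_iso w w' g <-> mul01 g (wat B) = mul10 (wat' B) g.
Proof. exact: conjugatesP. Qed.

(** Being an isomorphism is an equation in [E^1], so it may be tested on the
    factors of a fibre product. *)
Lemma iso_homogeneous : homogeneous (iso_functor w w').
Proof.
move=> B D D' P f g p q fp fS.
have fp' : is_fibre_product (hrestr f) (hrestr g) (hrestr p) (hrestr q) by [].
have fS' : hsurj (hrestr f) by [].
split=> [b c /(congr1 sval) /= bc|x y /(congr1 sval) /= px /(congr1 sval) /= qx].
  have /iso_objP hb := svalP b; have /iso_objP hc := svalP c.
  have [||t [pt qt ht]] := intertwiner_glue fp' fS' (w := wat P) (w' := wat' P) bc.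
  - by rewrite !fmap_hstr.
  - by rewrite !fmap_hstr.
  have ht' : is_iso w w' t by apply/iso_objP.
  by exists (exist _ t ht'); split; apply: iso_eq.
by apply: iso_eq; have [_ eI] := hE 0 fp' fS'; exact: eI.
Qed.

Section SquareZero.
Variable V : vectType k.
Local Notation S := (restr (sqzobj (art_res A) V)).

(** [k + V] becomes an [R]-algebra through [pi] or through [A]; the two structure
    maps agree pointwise only, and the identity of the underlying ring is an
    isomorphism between the two objects. *)
Lemma sqz_restr_str r : idfun (art_str S r) = art_str (sqzobj pi V) r.
Proof. by rewrite /= art_res_str. Qed.
Definition sqz_of_restr : hom S (sqzobj pi V) :=
  @Hom R k pi S (sqzobj pi V) idfun sqz_restr_str (fun=> erefl).
Lemma restr_sqz_str r : idfun (art_str (sqzobj pi V) r) = art_str S r.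
Proof. by rewrite /= art_res_str. Qed.
Definition restr_of_sqz : hom (sqzobj pi V) S :=
  @Hom R k pi (sqzobj pi V) S idfun restr_sqz_str (fun=> erefl).

Lemma sqz_of_restrK x :
  fmap (E 0) restr_of_sqz (fmap (E 0) sqz_of_restr x) = x.
Proof. by rewrite -fmap_comp -[RHS](fmap_id (E 0)); apply: fmap_ext. Qed.
Lemma restr_of_sqzK x :
  fmap (E 0) sqz_of_restr (fmap (E 0) restr_of_sqz x) = x.
Proof. by rewrite -fmap_comp -[RHS](fmap_id (E 0)); apply: fmap_ext. Qed.
Lemma restr_of_sqzK1 x :
  fmap (E 1) restr_of_sqz (fmap (E 1) sqz_of_restr x) = x.
Proof. by rewrite -fmap_comp -[RHS](fmap_id (E 1)); apply: fmap_ext. Qed.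

(** The structure map [A -> k + V] factors through [k]. *)
Lemma fmap_sqz_hstr (x : E 1 A) :
  fmap (E 1) sqz_of_restr (fmap (E 1) (hstr (sqzobj (art_res A) V)) x) = (0 : C 1 V).
Proof.
rewrite -fmap_comp (fmap_ext (E 1) _ (hcomp (hsqz_in pi V) (hres A))) // fmap_comp.
by congr (fmap _ _ _); exact: fpt_uniq.
Qed.

Lemma iso_sqzP (g : E 0 S) :
  is_iso (B := sqzobj (art_res A) V) w w' g <->
  diffV (fmap (E 0) sqz_of_restr g : C 0 V) = 0.
Proof.
rewrite iso_objP diffV0E; split=> [/(congr1 (fmap (E 1) sqz_of_restr))|/eqP].
  by rewrite fmap_mul01 fmap_mul10 !fmap_sqz_hstr => ->; rewrite subrr.
rewrite subr_eq0 => /eqP e; rewrite -[LHS]restr_of_sqzK1 -[RHS]restr_of_sqzK1.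
by congr (fmap _ _ _); rewrite fmap_mul01 fmap_mul10 !fmap_sqz_hstr.
Qed.

Definition iso_cochain (g : iso_functor w w' (sqzobj (art_res A) V)) :
  E 0 (sqzobj pi V) := fmap (E 0) sqz_of_restr (sval g).
End SquareZero.

Lemma iso_tangent (h : pointwise_homogeneous (iso_functor w w')) :
  linear_iso (tangent h) (cohomology E 0).
Proof.
pose f (g : tangent h) : cohomology E 0 := coclass (iso_cochain g : cochain E 0).
have dg (g : tangent h) : diff (iso_cochain g : cochain E 0) = 0.
  by rewrite -diffVE; apply/iso_sqzP; exact: (svalP g).
have L := @natural_linear k _ _ (art_res A) pi (iso_functor w w') (E 0) h
  (homogeneous_pointwise (hE 0)) iso_cochain.
have fL : linear f.
  move=> a x y; rewrite /f -coclass_linear //; congr coclass; apply: (L _ k^o) => V V' u g.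
  by rewrite /iso_cochain /lact /= -!fmap_comp; apply: fmap_ext.
pose fM : {linear tangent h -> cohomology E 0} := HB.pack f (GRing.isLinear.Build _ _ _ _ f fL).
exists fM; apply: inj_surj_bijective => [x y|c].
  move=> /(coclassP (dg x) (dg y)) /eqP; rewrite subr_eq0 => /eqP exy.
  apply: iso_eq; rewrite -[LHS]sqz_of_restrK -[RHS]sqz_of_restrK.
  by congr (fmap _ _ _).
have [z dz <-] := coclass_surj c.
have isoz : is_iso (B := sqzobj (art_res A) k^o) w w' (fmap (E 0) (restr_of_sqz k^o) z).
  by apply/iso_sqzP; rewrite restr_of_sqzK.
exists (exist _ _ isoz); rewrite /= /f /iso_cochain /=; congr coclass.
exact: restr_of_sqzK.
Qed.

Lemma framed_restr (B D : art (art_res A)) (f : hom B D) (V : vectType k) (j : {additive V -> B}) :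
  is_framed f j -> @is_framed _ _ pi (restr B) (restr D) (hrestr f) V j.
Proof. by case=> *; split. Qed.

Lemma iso_obstruction_space : complete_obstruction_space (iso_functor w w') (cohomology E 1).
Proof.
have fr (e : small_ext (art_res A)) := framed_restr (framed_frame e).
pose def (e : small_ext (art_res A)) (g : iso_functor w w' (se_tgt e))
    (o : C 1 'rV[k]_(frame_dim e)) :=
  exists x : E 0 (restr (se_src e)), fmap (E 0) (hrestr (se_hom e)) x = sval g /\
    iso_defect (fr e) (wat (se_src e)) (wat' (se_src e)) x o.
apply: (@obstruction_space_of_cocycles _ _ _ _ _ E _ 0 def).
- move=> e g o [x [_ /iso_defect_cocycle]]; apply; apply: is_mc_fmap; exact: svalP.
- move=> e g.
  have [x xg] := @sdc_smooth _ _ _ E 0 _ _ (hrestr (se_hom e)) (@se_surj _ _ _ e) (sval g).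
  have [|o xo] := @iso_defect_ex _ _ _ E _ _ _ _ _ (fr e) (wat (se_src e)) (wat' (se_src e)) x.
    by rewrite !fmap_hstr xg; exact: (svalP g).
  by exists o, x.
- move=> e g o o' [x [xg xo]] [x' [xg' xo']].
  have [|v ev] := shift_ex (fr e) (hE 0) (x := x) (y := x'); first by rewrite xg xg'.
  exists (- v); have := iso_defect_shift v xo; rewrite -ev => xo''.
  rewrite linearN /=.
  by apply: (shift_inj (fr := fr e) (x := mul10 (wat' (se_src e)) x')); rewrite -xo'' -xo'.
- move=> e e' a g o [x [xg xo]].
  exists (fmap (E 0) (hrestr (sem_src a)) x); split.
    by rewrite /= -xg -!fmap_comp; apply: fmap_ext => y; rewrite /= sem_comm_hom.
  rewrite -!(fmap_hstr (sem_src a)).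
  by apply: iso_defect_fmap xo => v; rewrite /= coframeK sem_comm_inc.
- move=> e g [g' <-]; exists (sval g'); split=> //.
  by apply/iso_defect0; exact: (svalP g').
- move=> e g v [x [xg xo]].
  have := iso_defect_shift v xo; rewrite subrr => /iso_defect0 isoy.
  exists (exist (@is_iso _ _ _ _ _ w w' (se_src e)) _ isoy).
  by apply: iso_eq; rewrite /= fmap_shift.
Qed.
End IsoFunctor.

Theorem theorem2p12 (Lambda : comNzRingType) (k : fieldType)
    (pi : {rmorphism Lambda -> k})
    (hLambda : complete_noetherian_local Lambda)
    (hpi : forall c, exists x, pi x = c)
    (E : sdc pi) :
  [/\ exists h : deformation_functor (def_functor E),
        linear_iso (tangent (deformation_pointwise h)) (cohomology E 1),
      complete_obstruction_space (def_functor E) (cohomology E 2),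
      forall (A : art pi) (w w' : mc E A),
        (exists h : homogeneous (iso_functor w w'),
          linear_iso (tangent (homogeneous_pointwise h)) (cohomology E 0)) /\
        complete_obstruction_space (iso_functor w w') (cohomology E 1) &
      (forall x : cohomology E 0, x = 0) -> homogeneous (def_functor E)].
Proof.
split.
- by exists (def_deformation_functor E); exact: def_tangent.
- exact: def_obstruction_space.
- move=> A w w'; split; last exact: iso_obstruction_space.
  by exists (iso_homogeneous w w'); exact: iso_tangent.
- exact: def_homogeneous.
Qed.
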